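(* Let $n\geq 12$ be an even integer. Among all binary trees on $n$ vertices, the distance between centroid and subtree core is maximized by a crg tree; that is, there is a crg tree $T^*$ on $n$ vertices such that $d_T(C_d(T),S_c(T))\leq d_{T^*}(C_d(T^* ),S_c(T^* ))$ for every binary tree $T$ on $n$ vertices.
   Context: All graphs are finite, simple, connected and undirected. A pendant vertex is a vertex of degree $1$. A binary tree is a tree in which every non-pendant vertex has degree $3$ (so its number of vertices is even). Centroid and subtree core: a subtree of $T$ is a (nonempty) connected subgraph of $T$. A branch at $v\in V(T)$ is a maximal subtree of $T$ containing $v$ as a pendant vertex; the weight of $v$ is the maximum number of edges in a branch at $v$; the centroid $C_d(T)$ is the set of vertices of minimum weight. $f_T(v)$ is the number of subtrees of $T$ containing $v$; the subtree core $S_c(T)$ is the set of vertices $v$ for which $f_T(v)$ is maximum. For $X,Y\subseteq V(T)$, $d_T(X,Y)=\min\{d_T(x,y):x\in X,y\in Y\}$. The eccentricity of $v$ is $\max_u d_T(u,v)$. Rooted binary trees: a rooted binary tree is a rooted tree whose root has degree $2$ and in which every other vertex has degree $1$ or $3$; the single-vertex rooted tree is also allowed. The height (level) of a vertex is its distance to the root. A rooted binary tree is ordered if the vertices of each level $l\ge 1$ are linearly ordered so that two vertices at level $l+1$ with different parents are ordered as their parents are at level $l$. A rooted binary tree is rgood if (i) the heights of any two of its pendant vertices differ by at most $1$, and (ii) it can be ordered so that the parents of the pendant vertices at the highest level form a final segment in the ordering of the vertices at the next-to-highest level. For each odd $l$ there is, up to isomorphism, exactly one rgood binary tree on $l$ vertices,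 denoted $T_{rg}^l$. Crg trees: a binary caterpillar is a binary tree having a path such that every vertex not on the path is adjacent to a vertex of the path. For even $n\ge 4$ and odd $l$ with $3\le l<n$, the crg tree $T_{rg}^{n,l}$ is the tree on $n$ vertices obtained by identifying the root of $T_{rg}^l$ with a vertex of maximum eccentricity of a binary caterpillar on $n-l+1$ vertices. *)

(* Defs.v *)
From mathcomp Require Import all_boot.

Set Implicit Arguments.
Unset Strict Implicit.
Unset Printing Implicit Defensive.

Record graph := Graph {
  vertex :> finType;
  adj : rel vertex;
  adj_sym : symmetric adj;
  adj_irr : irreflexive adj
}.

Definition isomorphic (G H : graph) : Prop :=
  exists f : G -> H, bijective f /\ forall x y, adj (f x) (f y) = adj x y.

Section Graphs.
Variable G : graph.
Implicit Types (u v x y : G) (X Y S : {set G}) (F : {set {set G}}).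

Definition deg v : nat := #|[set u | adj v u]|.
Definition pendant v : bool := deg v == 1.

Definition connected_graph : Prop :=
  0 < #|G| /\ forall x y, connect (@adj G) x y.

Definition acyclic : Prop :=
  forall c : seq G, ucycle (@adj G) c -> size c <= 2.

Definition tree : Prop := connected_graph /\ acyclic.

Definition binary_tree : Prop :=
  tree /\ forall v, ~~ pendant v -> deg v = 3.

(* Both minima below have the default value #|G|: it exceeds every distance in
   a connected graph, and is the value returned for unreachable vertices
   (respectively, for an empty set of vertices). *)
Definition dist x y : nat :=
  \big[minn/#|G|]_(k < #|G| |
     [exists p : k.-tuple G, path (@adj G) x p && (last x p == y)]) k.

Definition set_dist X Y : nat :=
  \big[minn/#|G|]_(x in X) \big[minn/#|G|]_(y in Y) dist x y.

Definition ecc v : nat := \max_(u : G) dist u v.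

Definition edges : {set {set G}} :=
  [set [set p.1; p.2] | p : G * G & adj p.1 p.2].

(* A subgraph is a pair of a set of vertices and a set of edges; it need not be
   induced. *)
Definition pregraph : finType := ({set G} * {set {set G}})%type.
Implicit Types H K : pregraph.

Definition subgraph H : bool :=
  (H.2 \subset edges) && [forall E in H.2, E \subset H.1].

Definition subgraph_le H K : bool :=
  (H.1 \subset K.1) && (H.2 \subset K.2).

Definition subtree H : bool :=
  [&& subgraph H, H.1 != set0 &
      [forall x in H.1, forall y in H.1,
         connect [rel a b | [set a; b] \in H.2] x y]].

Definition pendant_in v H : bool :=
  (v \in H.1) && (#|[set E in H.2 | v \in E]| == 1).

Definition branch v H : bool :=
  [&& subtree H, pendant_in v H &
      [forall K : pregraph,
         [&& subtree K, pendant_in v K & subgraph_le H K] ==> (K == H)]].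

Definition weight v : nat :=
  \max_(H : pregraph | branch v H) #|H.2|.

Definition centroid : {set G} := [set v | [forall u, weight v <= weight u]].

Definition nb_subtrees v : nat :=
  #|[set H : pregraph | subtree H && (v \in H.1)]|.

Definition subtree_core : {set G} :=
  [set v | [forall u, nb_subtrees u <= nb_subtrees v]].

Definition binary_caterpillar : Prop :=
  binary_tree /\
  exists (x : G) (p : seq G),
    [/\ path (@adj G) x p, uniq (x :: p) &
        forall v, v \notin x :: p -> exists2 u, u \in x :: p & adj v u].

Definition max_ecc_vertex v : Prop := forall u, ecc u <= ecc v.

Section Rooted.
Variable r : G.

Definition rooted_binary_tree : Prop :=
  tree /\
  (#|G| = 1 \/
   deg r = 2 /\ forall v, v != r -> deg v = 1 \/ deg v = 3).

Definition height v : nat := dist r v.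
Definition level (l : nat) : {set G} := [set v | height v == l].
Definition parent p v : bool := adj p v && (height v == (height p).+1).

Definition linear_order_on X (o : rel G) : Prop :=
  [/\ {in X, reflexive o}, {in X &, antisymmetric o},
      {in X & &, transitive o} & {in X &, total o}].

(* Only the restrictions of o to the levels l >= 1 are meaningful. *)
Definition ordering (o : rel G) : Prop :=
  (forall l, 1 <= l -> linear_order_on (level l) o) /\
  (forall l x y px py, 1 <= l ->
     x \in level l.+1 -> y \in level l.+1 ->
     parent px x -> parent py y -> px != py -> o x y = o px py).

Definition highest_level : nat := \max_(v : G) height v.

Definition top_pendant_parent p : bool :=
  [exists v, [&& pendant v, height v == highest_level & parent p v]].

Definition rgood : Prop :=
  [/\ rooted_binary_tree,
      (forall x y, pendant x -> pendant y -> height x <= (height y).+1) &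
      exists2 o : rel G, ordering o &
        forall x y, (height x).+1 = highest_level ->
          (height y).+1 = highest_level ->
          top_pendant_parent x -> o x y -> top_pendant_parent y].

End Rooted.
End Graphs.

(* Disjoint union of R and C with r and c identified: the vertex c of C is
   deleted and r takes over its neighbours. *)
Section Glue.
Variables (R C : graph) (r : R) (c : C).

Definition glue_vertex : finType := (R + {x : C | x != c})%type.

Definition glue_adj : rel glue_vertex := fun a b =>
  match a, b with
  | inl x, inl y => adj x y
  | inr x, inr y => adj (val x) (val y)
  | inl x, inr y => (x == r) && adj c (val y)
  | inr x, inl y => (y == r) && adj c (val x)
  end.

Lemma glue_adj_sym : symmetric glue_adj.
Proof. by move=> [x|x] [y|y] //=; apply: adj_sym. Qed.

Lemma glue_adj_irr : irreflexive glue_adj.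
Proof. by move=> [x|x] /=; apply: adj_irr. Qed.

Definition glue : graph := Graph glue_adj_sym glue_adj_irr.

End Glue.

Definition crg_tree (n l : nat) (G : graph) : Prop :=
  [/\ ~~ odd n, 4 <= n, odd l, 3 <= l < n &
      exists (R C : graph) (r : R) (c : C),
        [/\ rgood r /\ #|R| = l,
            binary_caterpillar C /\ #|C| = n - l + 1,
            max_ecc_vertex c &
            isomorphic G (glue r c)]].

(* Main.v *)
(* Let x in the centroid and y in the subtree core of T be at minimal distance
   d > 0. Comparing both ends of an edge, the centroid lies in its larger side,
   and the subtree core in the side with more subtrees rooted at the end of the
   edge. So, if A is the side of y of the last edge of the path from x to y, and
   B the other side, then A has more rooted subtrees than B, while
   2 (|A| + 2 (d - 1)) < n because the side of y of the first edge contains A and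
   at least two more vertices per step.
   Among rooted binary trees with a given number of vertices, the rgood tree has
   the most rooted subtrees and the caterpillar has the fewest. Hence both
   inequalities persist in the crg tree with l = |A|, where they put the subtree
   core in the rgood part and the centroid at distance at least d from its root. *)
Require Import Defs.
From mathcomp Require Import all_boot.
From mathcomp Require Import zify.

Set Implicit Arguments.
Unset Strict Implicit.
Unset Printing Implicit Defensive.

(** Counting the empty set along with the rooted subtrees gives a number h that is 2 at a leaf and
    h1 h2 + 1 above children with values h1 and h2. A rooted binary tree with k leaves has 2k - 1
    vertices, so both extremal claims become inequalities between functions of k:
    [hopt a * hopt b + 1 <= hopt (a + b)] and [hcat (a + b) <= hcat a * hcat b + 1]. Given these,
    induction on the size of a side suffices; no tree is ever transformed. The first inequality is
    the obstacle: [hopt] follows the irregular shape of the rgood tree, so it is proved by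
    exchanging pieces of the two halves, not by estimates. The definitions are the other obstacle:
    subtrees carry edge sets and branches are given by maximality. Both are reduced to vertex sets
    and sides of edges. The crg tree lives on an initial segment of the integers with parents
    smaller than children, so adjacency is arithmetic and the sides to be measured are initial
    segments. *)

(** * Rooted subtrees of rgood trees *)

(* One more than the number of subtrees containing the root of the rgood tree
   with [2 ^ m + e] leaves, for [e <= 2 ^ m]. *)
Fixpoint hlev (m e : nat) : nat :=
  if m is m'.+1 then
    if e <= 2 ^ m' then (hlev m' 0 * hlev m' e).+1
    else (hlev m' (2 ^ m') * hlev m' (e - 2 ^ m')).+1
  else if e == 0 then 2 else 5.

(** The complete tree with [2 ^ m.+1] leaves has two descriptions, as all of level [m] split or none
    of level [m.+1]; the recursion must not distinguish them. *)
Lemma hlev_full m : hlev m (2 ^ m) = hlev m.+1 0.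
Proof.
elim: m => [//|m IH].
have h : (2 ^ m.+1 <= 2 ^ m) = false by rewrite leq_exp2l // ltnn.
have h2 : 2 ^ m.+1 - 2 ^ m = 2 ^ m by rewrite expnS; lia.
by rewrite [LHS]/= h h2 IH [RHS]/=.
Qed.

Lemma hlev_mono m e e' : e <= e' -> e' <= 2 ^ m -> hlev m e <= hlev m e'.
Proof.
elim: m e e' => [|m IH] e e' ee' le' /=; first by move: e e' ee' le' => [|[|e]] [|[|e']].
rewrite expnS in le'.
case: (leqP e) => h; case: (leqP e') => h'; try lia.
- by rewrite ltnS; apply: leq_mul => //; apply: IH.
- by rewrite ltnS mulnC; apply: leq_mul; apply: IH => //; lia.
- by rewrite ltnS; apply: leq_mul => //; apply: IH; lia.
Qed.

(* [hlev] as a function of the number of leaves. *)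
Definition hopt (k : nat) : nat :=
  hlev (trunc_log 2 k) (k - 2 ^ trunc_log 2 k).

Lemma hoptE m e : e <= 2 ^ m -> hopt (2 ^ m + e) = hlev m e.
Proof.
have main q f : f < 2 ^ q -> hopt (2 ^ q + f) = hlev q f.
  move=> lf; rewrite /hopt (@trunc_log_eq 2 q) ?addKn //.
  by rewrite leq_addr expnS; lia.
rewrite leq_eqVlt => /orP[/eqP->|]; last exact: main.
have := main m.+1 0 (ltac:(by rewrite expn_gt0)).
by rewrite hlev_full addn0 expnS mul2n addnn.
Qed.

Lemma hopt_pow m : hopt (2 ^ m) = hlev m 0.
Proof. by rewrite -[2 ^ m]addn0 hoptE. Qed.

(** The highest level fills one half before the other, so one half of an rgood tree is always
    complete: of depth [m] here, of depth [m.+1] in [hopt_high]. *)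
Lemma hopt_low m d : 2 ^ m <= d <= 2 ^ m.+1 ->
  hopt (2 ^ m + d) = (hopt (2 ^ m) * hopt d).+1.
Proof.
case/andP=> l1 l2; rewrite expnS in l2.
have [e de] : exists e, d = 2 ^ m + e by exists (d - 2 ^ m); lia.
have le : e <= 2 ^ m by lia.
rewrite hopt_pow de (hoptE le).
have -> : 2 ^ m + (2 ^ m + e) = 2 ^ m.+1 + e by rewrite expnS; lia.
by rewrite hoptE /= ?le // expnS; lia.
Qed.

Lemma hopt_high m d : 2 ^ m <= d <= 2 ^ m.+1 ->
  hopt (2 ^ m.+1 + d) = (hopt (2 ^ m.+1) * hopt d).+1.
Proof.
case/andP=> l1 l2; rewrite expnS in l2.
have [e de] : exists e, d = 2 ^ m + e by exists (d - 2 ^ m); lia.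
have le : e <= 2 ^ m by lia.
rewrite hopt_pow -hlev_full de (hoptE le) hoptE; last by rewrite expnS; lia.
rewrite /=; case: leqP => h; last by rewrite addKn.
have -> : e = 0 by lia.
by rewrite addn0 mulnC.
Qed.

Lemma hopt_mono a b : 0 < a -> a <= b -> hopt a <= hopt b.
Proof.
move=> a0 ab; rewrite -(subnKC ab); elim: (b - a) => [|d IH]; first by rewrite addn0.
rewrite addnS; apply: (leq_trans IH).
move: (a + d) (ltn_addr d a0) => k k0.
have /andP[] := trunc_log_bounds (isT : 1 < 2) k0.
move: (trunc_log 2 k) => m l1; rewrite expnS => l2.
have [e de] : exists e, k = 2 ^ m + e by exists (k - 2 ^ m); lia.
rewrite de -addnS !hoptE; try lia.
apply: hlev_mono; lia.
Qed.

Lemma hopt_gt0 k : 0 < hopt k.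
Proof. by rewrite /hopt; case: trunc_log => [|m] /=; case: ifP. Qed.

(** Since (y' - x)(y' - y) >= 0, the product [y' * (x + y)] is at most [y' * y' + x * y], hence at
    most [y' * (x' + y')]. *)
Lemma spread_sum x y x' y' :
  0 < y' -> x <= y' -> y <= y' -> x * y <= x' * y' -> x + y <= x' + y'.
Proof.
move=> y0 xy yy p; rewrite -(leq_pmul2r y0).
have [u hu] : exists u, y' = x + u by exists (y' - x); lia.
have [v hv] : exists v, y' = y + v by exists (y' - y); lia.
suff : u * v + y' * (x + y) = y' * y' + x * y by lia.
have : y' * y' = (x + u) * (y + v) by rewrite -hu -hv.
have -> : y' * (x + y) = (y + v) * x + (x + u) * y by rewrite -hu -hv; lia.
lia.
Qed.

(* The split of [a + b] into the leaf counts [c <= d] of the two subtrees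
   of the root of the rgood tree. *)
Lemma rgood_split m a b :
  2 ^ m <= a <= 2 ^ m.+1 -> 2 ^ m <= b <= 2 ^ m.+1 ->
  exists c d, [/\ c + d = a + b, c = 2 ^ m \/ d = 2 ^ m.+1,
    [/\ 2 ^ m <= c <= 2 ^ m.+1, 2 ^ m <= d <= 2 ^ m.+1, a <= d & b <= d] &
    hopt (a + b) = (hopt c * hopt d).+1].
Proof.
move=> /andP[a1 a2] /andP[b1 b2]; have pS := expnS 2 m.
have [h|h] := leqP (a + b) (3 * 2 ^ m).
  exists (2 ^ m), (a + b - 2 ^ m); split; [lia|by left|split; lia|].
  by rewrite -hopt_low; [congr hopt|]; lia.
exists (a + b - 2 ^ m.+1), (2 ^ m.+1); split; [lia|by right|split; lia|].
by rewrite mulnC -hopt_high; [congr hopt|]; lia.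
Qed.

(** Optimality of the rgood split among all splits at the root. The outer induction is on [a + b],
    the inner one on the larger part [b], so that [IH'] covers every more balanced split. Otherwise
    [b], and if necessary [a], is cut into its two rgood halves, and the pieces are regrouped into
    the rgood split of [a + b]. *)
Lemma hopt_opt a b : 0 < a -> 0 < b -> hopt a * hopt b < hopt (a + b).
Proof.
have [n le_n] := ubnP (a + b); elim: n a b le_n => // n IHn a b.
wlog : a b / a <= b.
  move=> H le_n a0 b0; case/orP: (leq_total a b) => ab; first exact: H.
  by rewrite mulnC addnC; apply: H => //; rewrite addnC.
have [N leN] := ubnP b; elim: N a b leN => // N IHN a b leN ab le_n a0 b0.
have IH' c d : c < N -> d < N -> c + d = a + b -> 0 < c -> 0 < d ->
    hopt c * hopt d < hopt (a + b).
  move=> cN dN e c0 d0; rewrite -e.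
  case/orP: (leq_total c d) => cd; first by apply: IHN => //; rewrite e.
  by rewrite mulnC addnC; apply: IHN => //; rewrite addnC e.
have [b1|b1] := leqP b 1.
  have -> : b = 1 by lia.
  by have -> : a = 1 by lia.
have [p [lp1 lp2]] : exists p, 2 ^ p.+1 <= b /\ b < 2 ^ p.+2.
  have /andP[] := trunc_log_bounds (isT : 1 < 2) b0.
  case: (trunc_log 2 b) => [|p]; first by rewrite expn1; lia.
  by move=> *; exists p.
have pS := expnS 2 p; have pSS := expnS 2 p.+1.
have p0 : 0 < 2 ^ p by rewrite expn_gt0.
set c := 2 ^ p in pS p0; set c2 := 2 ^ p.+1 in lp1 pS pSS.
set c4 := 2 ^ p.+2 in lp2 pSS.
have Ec2 : hopt c2 = (hopt c * hopt c).+1.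
  by rewrite -hopt_low -/c -/c2 /c2 ?expnS; [congr hopt|]; lia.
have Ec4 : hopt c4 = (hopt c2 * hopt c2).+1.
  by rewrite -hopt_low -/c2 -/c4 /c4 ?expnS; [congr hopt|]; lia.
(* The rgood halves of [x]: up to [3 * c] leaves the smaller half is complete with [c] leaves,
   beyond that the larger one is complete with [c2]. *)
have dec x : c2 <= x <= c4 ->
    (exists2 y, x = c + y & c <= y <= c2) \/ (exists2 y, x = c2 + y & c < y <= c2).
  move=> hx; have [h|h] := leqP x (3 * c); [left; exists (x - c)|right; exists (x - c2)]; lia.
have low y : c <= y <= c2 -> hopt (c + y) = (hopt c * hopt y).+1 by exact: hopt_low.
have high y : c <= y <= c2 -> hopt (c2 + y) = (hopt c2 * hopt y).+1 by exact: hopt_high.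
have low2 y : c2 <= y <= c4 -> hopt (c2 + y) = (hopt c2 * hopt y).+1 by exact: hopt_low.
have high2 y : c2 <= y <= c4 -> hopt (c4 + y) = (hopt c4 * hopt y).+1 by exact: hopt_high.
(* If [a] is smaller than the larger child [b2] of [b], exchange the two. *)
have swap b1' b2 : b = b1' + b2 -> 0 < b1' -> a < b2 ->
    hopt b = (hopt b1' * hopt b2).+1 -> hopt a * hopt b < hopt (a + b).
  move=> eb b1'0 ab2 ->.
  have i1 := @IHn a b1' (ltac:(lia)) a0 b1'0.
  have i2 := IH' b2 (a + b1') (ltac:(lia)) (ltac:(lia)) (ltac:(lia)) (ltac:(lia)) (ltac:(lia)).
  have i3 := hopt_mono a0 (ltnW ab2).
  by apply: leq_ltn_trans i2; nia.
(* Passing to the rgood split [u], [v] of [x + y] decreases neither the product, by [IHn], nor the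
   sum, by [spread_sum]. *)
have split x y : c <= x <= c2 -> c <= y <= c2 -> x + y < a + b ->
  exists u v, [/\ u + v = x + y, u = c \/ v = c2,
    c <= u <= c2 /\ c <= v <= c2,
    hopt x * hopt y <= hopt u * hopt v &
    hopt x <= hopt v /\ hopt x + hopt y <= hopt u + hopt v /\ hopt y <= hopt v].
  move=> hx hy lt; have [u [v [e1 e2 [e3 e4 e5 e6] e7]]] := rgood_split hx hy.
  have i1 := @IHn x y (ltac:(lia)) (ltac:(lia)) (ltac:(lia)).
  have m1 : hopt x <= hopt v by apply: hopt_mono; lia.
  have m2 : hopt y <= hopt v by apply: hopt_mono; lia.
  have pr : hopt x * hopt y <= hopt u * hopt v by rewrite e7 in i1; lia.
  exists u, v; split => //; split => //; split => //.
  by apply: spread_sum => //; apply: hopt_gt0.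
have pC := hopt_gt0 c; have pC2 := hopt_gt0 c2.
case: (dec b) => [|[y eb hy]|[y eb hy']]; first lia.
- have Eb := low _ hy; rewrite -eb in Eb.
  have [lt|ge] := ltnP a y; first by apply: swap Eb.
  have [ac|ac] := leqP a c2.
  + have [u [v [e1 e2 [e3 e4] e5 [e6 [e7 e8]]]]] := split a y (ltac:(lia)) hy (ltac:(lia)).
    (* [v] replaces [a], and [u] replaces the half [y] of [b]. As [u = c] or [v = c2], the parts [v]
       and [c + u] form the rgood split of [a + b]. *)
    have B : hopt a * hopt b <= hopt v * hopt (c + u).
      by rewrite Eb low //; nia.
    apply: leq_ltn_trans B _; case: e2 => e2.
    * have -> : a + b = c2 + v by lia.
      have -> : c + u = c2 by lia.
      by rewrite high // mulnC.
    * have -> : a + b = c2 + (c + u) by lia.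
      by rewrite low2 ?e2 //; lia.
  + case: (dec a) => [|[x ea hx]|[x ea hx]]; first lia.
    (* The pieces c, x, c, y are regrouped as c + c and x + y; the gain comes from
       [(X - C) * (Y - C) >= 0] for their values. *)
    * have i1 := @IHn x y (ltac:(lia)) (ltac:(lia)) (ltac:(lia)).
      have -> : a + b = c2 + (x + y) by lia.
      have m1 : hopt c <= hopt x by apply: hopt_mono; lia.
      have m2 : hopt c <= hopt y by apply: hopt_mono; lia.
      rewrite low2 ?ltnS; last lia.
      apply: leq_trans (_ : hopt c2 * (hopt x * hopt y).+1 <= _); last by rewrite leq_mul2l i1 orbT.
      by rewrite Eb ea low // Ec2; move: (hopt c) (hopt x) (hopt y) m1 m2 => C X Y m1 m2; nia.
    * lia.
- have hy : c <= y <= c2 by lia.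
  have Eb := high _ hy; rewrite -eb in Eb.
  have [lt|ge] := ltnP a c2.
    by apply: (swap y c2) => //; [lia|lia|rewrite mulnC].
  case: (dec a) => [|[x ea hx]|[x ea hx]]; first lia.
  + have [ac|ac] := leqP a c2.
      have -> : a = c2 by lia.
      by rewrite low2 //; lia.
    have [u [v [e1 e2 [e3 e4] e5 [e6 [e7 e8]]]]] := split x y hx hy (ltac:(lia)).
    have m : hopt c <= hopt c2 by apply: hopt_mono; lia.
    have B : hopt a * hopt b <= hopt (c + u) * hopt (c2 + v).
      rewrite Eb ea !low // high //.
      move: (hopt c) (hopt c2) (hopt x) (hopt y) (hopt u) (hopt v) m e5 e6 e7 e8.
      move=> C Q X Y U V m e5 e6 e7 e8.
      (* The mixed terms [C * X + Q * Y] are rewritten so that they visibly grow with the sum and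
         with the value of the larger part. *)
      have : C * (X + Y) + (Q - C) * Y <= C * (U + V) + (Q - C) * V.
        by rewrite leq_add // leq_mul2l ?e7 ?e8 ?orbT.
      have : C * Q * (X * Y) <= C * Q * (U * V) by rewrite leq_mul2l e5 orbT.
      have [q ->] : exists q, Q = C + q by exists (Q - C); lia.
      rewrite addKn; lia.
    apply: leq_ltn_trans B _; case: e2 => e2.
    * have -> : a + b = c2 + (c2 + v) by lia.
      have -> : c + u = c2 by lia.
      by rewrite (low2 (c2 + v)) //; lia.
    * have -> : a + b = c4 + (c + u) by lia.
      have -> : c2 + v = c4 by lia.
      by rewrite high2 1?mulnC //; lia.
  (* The pieces c2, x, c2, y are regrouped as c4 and x + y; now x and y are both at most c2, so the
     same product of differences is again nonnegative. *)
  + have {}hx : c <= x <= c2 by lia.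
    have i1 := @IHn x y (ltac:(lia)) (ltac:(lia)) (ltac:(lia)).
    have -> : a + b = c4 + (x + y) by lia.
    have m1 : hopt x <= hopt c2 by apply: hopt_mono; lia.
    have m2 : hopt y <= hopt c2 by apply: hopt_mono; lia.
    rewrite high2 ?ltnS; last lia.
    apply: leq_trans (_ : hopt c4 * (hopt x * hopt y).+1 <= _); last by rewrite leq_mul2l i1 orbT.
    rewrite Eb ea high // Ec4; move: (hopt c2) (hopt x) (hopt y) m1 m2 => C X Y m1 m2; nia.
Qed.

(* The analogue of [hopt] for caterpillars rooted at an end. *)
Definition hcat (k : nat) : nat := 3 * 2 ^ k.-1 - 1.

(** With A = 2^(a-1) and B = 2^(b-1) the two sides differ by 3 (A - 1)(B - 1). *)
Lemma hcat_add a b : 0 < a -> 0 < b -> hcat (a + b) <= (hcat a * hcat b).+1.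
Proof.
case: a b => [//|a] [//|b] _ _; rewrite /hcat addSn addnS /= expnS expnD.
have := expn_gt0 2 a; have := expn_gt0 2 b => /=.
by move: (2 ^ a) (2 ^ b) => A B; nia.
Qed.

Lemma hcat_succ k : 0 < k -> hcat k.+1 = (2 * hcat k).+1.
Proof.
case: k => // k _; rewrite /hcat /= expnS; have := expn_gt0 2 k => /=; lia.
Qed.

(** * Sides of the edges of a tree *)

Section Relations.
Variable T : finType.
Implicit Types (e : rel T) (u v x y : T).

Definition avoid e u a b := [&& e a b, a != u & b != u].
Arguments avoid e u a b /.

Lemma avoid_path e u x p : path e x p -> u \notin x :: p -> path (avoid e u) x p.
Proof.
elim: p x => //= y p IH x /andP[exy pth].
rewrite !inE !negb_or => /and3P[ux uy up].
by rewrite IH // ?inE ?negb_or ?uy // andbT exy ![_ == u]eq_sym ux uy.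
Qed.

Lemma avoid_pathW e u x p : path (avoid e u) x p -> path e x p /\ u \notin p.
Proof.
elim: p x => //= y p IH x /andP[/and3P[exy _ yu]] /IH[-> up].
by rewrite exy inE negb_or eq_sym yu.
Qed.

Lemma connect_avoid_neq e u x y : x != u -> connect (avoid e u) x y -> y != u.
Proof.
move=> xu /connectP[p /avoid_pathW[_ up] ->]; apply: contraNneq up => eu.
by case: p eu => [/eqP|z p /= <-]; [rewrite (negPf xu)|apply: mem_last].
Qed.

(** A simple path never returns to its start, so everything after its first edge avoids [u]. *)
Lemma connect_first_step e u x : connect e u x -> x != u ->
  exists2 w, e u w & connect (avoid e u) w x.
Proof.
case/connectP=> p pth ->; case/shortenP: pth => {}p pth unq _.
case: p pth unq => [|w p] /= => [_ _|/andP[euw pth] /andP[up _] _]; first by rewrite eqxx.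
by exists w => //; apply/connectP; exists p => //; apply: avoid_path.
Qed.

(** Every vertex on a path from [a] is itself reachable from [a]. Recording this on each step lets
    facts about reachable vertices be used when a connection is transported to another relation. *)
Lemma connect_inner e a x : connect e a x ->
  connect [rel b c | [&& e b c, connect e a b & connect e a c]] a x.
Proof.
case/connectP=> p + ->; elim/last_ind: p => [|p y IH]; first by rewrite connect0.
rewrite rcons_path last_rcons => /andP[pth ey].
have cl : connect e a (last a p) by apply/connectP; exists p.
apply: connect_trans (IH pth) (connect1 _) => /=.
by rewrite ey cl (connect_trans cl (connect1 ey)).
Qed.

End Relations.
Arguments avoid {T} e u a b /.

Lemma eq_set2 (T : finType) (a b c d : T) :
  [set a; b] = [set c; d] -> (a = c /\ b = d) \/ (a = d /\ b = c).
Proof.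
move/setP=> h; move: (h a) (h b) (h c) (h d).
rewrite !inE !eqxx ?orbT /= => /esym/orP h1 /esym/orP h2 /orP h3 /orP h4.
case: h1 => /eqP h1; case: h2 => /eqP h2; case: h3 => /eqP h3; case: h4 => /eqP h4; subst; tauto.
Qed.

Section Tree.
Variable G : graph.
Hypothesis treeG : tree G.
Implicit Types (u v w x y a b : G) (S : {set G}).

Notation adj := (@adj G).

Lemma adj_neq u v : adj u v -> u != v.
Proof. by apply: contraTneq => ->; rewrite adj_irr. Qed.

Lemma adjC u v : adj u v = adj v u. Proof. exact: adj_sym. Qed.

(* The vertex set of the component of [v] in [G - u]. *)
Definition side u v : {set G} := [set x | connect (avoid adj u) v x].

Lemma avoid_connC u : connect_sym (avoid adj u).
Proof. by apply: sym_connect_sym => x y /=; rewrite adjC andbA andbAC -andbA. Qed.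

Lemma side_refl u v : v \in side u v.
Proof. by rewrite inE connect0. Qed.

Lemma side_neq u v x : adj u v -> x \in side u v -> x != u.
Proof. by move=> /adj_neq uv; rewrite inE; apply: connect_avoid_neq; rewrite eq_sym. Qed.

Lemma side_step u v x y : x \in side u v -> adj x y -> x != u -> y != u -> y \in side u v.
Proof.
rewrite !inE => cx xy xu yu; apply: connect_trans cx (connect1 _).
by rewrite /= xy xu yu.
Qed.

(** Acyclicity enters here: a path from [w1] to [w2] avoiding [u] would close up to a cycle through
    [u]. *)
Lemma side_inj u w1 w2 x :
  adj u w1 -> adj u w2 -> x \in side u w1 -> x \in side u w2 -> w1 = w2.
Proof.
move=> uw1 uw2; rewrite !inE => c1 c2.
have : connect (avoid adj u) w1 w2.
  by apply: connect_trans c1 _; rewrite avoid_connC.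
case/connectP=> p pth e; case/shortenP: pth e => {}p pth unq _ e.
have [pth' up] := avoid_pathW pth.
case: p e pth' up unq {pth} => [-> //|y p] e pth' up unq.
have /(proj2 treeG) : ucycle adj (u :: w1 :: y :: p); last by [].
rewrite /ucycle /= in pth' unq e *.
case/andP: pth' => -> pth'; rewrite uw1 rcons_path pth' -e adjC uw2 /=.
by rewrite in_cons negb_or (adj_neq uw1) up.
Qed.

Lemma side_exists u x : x != u -> exists2 w, adj u w & x \in side u w.
Proof.
move=> xu; have [w uw c] := connect_first_step ((proj2 (proj1 treeG)) u x) xu.
by exists w; rewrite ?inE.
Qed.

(** A path from [u] that avoids [v] starts toward another neighbour of [u], and by [side_inj] it
    stays apart from the side of [v]. *)
Lemma sideC u v : adj u v -> side v u = ~: side u v.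
Proof.
move=> uv; have vu : adj v u by rewrite adjC.
apply/setP=> x; rewrite [RHS]inE; apply/idP/idP => [xv|xu].
  apply/negP => xu; have xneq := side_neq uv xu.
  move: (xv); rewrite inE => c; have [w /and3P[uw _ wv] c'] := connect_first_step c xneq.
  have xw : x \in side u w.
    by rewrite inE; apply: connect_sub c' => a b /and3P[/and3P[ab _ _] au bu]; apply: connect1; apply/and3P.
  by rewrite (side_inj uw uv xw xu) eqxx in wv.
have [->|xneq] := eqVneq x u; first exact: side_refl.
have [w uw xw] := side_exists xneq.
have wv : w != v by apply: contraNneq xu => <-.
rewrite inE; apply: (@connect_trans _ _ w).
  by apply: connect1; rewrite /= uw wv adj_neq.
move: xw; rewrite inE => /connect_inner; apply: connect_sub => a b /and3P[/and3P[ab _ _] ca cb].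
have nv y : connect (avoid adj u) w y -> y != v.
  move=> cy; apply: contraNneq wv => yv; apply/eqP; apply: (@side_inj u _ _ v) => //.
    by rewrite -yv inE.
  exact: side_refl.
by apply: connect1; apply/and3P; rewrite !nv.
Qed.

Lemma in_sideC u v x : adj u v -> (x \in side v u) = (x \notin side u v).
Proof. by move=> uv; rewrite sideC // inE. Qed.

Lemma card_sideC u v : adj u v -> #|side u v| + #|side v u| = #|G|.
Proof. by move=> uv; rewrite (sideC uv) cardsC cardT -cardE. Qed.

Lemma side_gt0 u v : 0 < #|side u v|.
Proof. by apply/card_gt0P; exists v; apply: side_refl. Qed.

Definition nbrs v (s : seq G) : Prop := uniq s /\ forall x, adj v x = (x \in s).

Lemma side_nbrs1 u v : nbrs v [:: u] -> side u v = [set v].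
Proof.
case=> _ h; have vu : adj v u by rewrite h inE.
apply/setP=> x; rewrite in_sideC // inE; apply/idP/eqP => [xu|->].
  apply/eqP; apply: contraNT xu => /side_exists[w]; rewrite h inE => /eqP->; exact.
by apply/negP => /(side_neq vu); rewrite eqxx.
Qed.

Lemma side_nbrs3 u v w1 w2 : nbrs v [:: u; w1; w2] ->
  side u v = v |: (side v w1 :|: side v w2).
Proof.
case=> unq h; have vu : adj v u by rewrite h inE eqxx.
have vw1 : adj v w1 by rewrite h !inE eqxx ?orbT.
have vw2 : adj v w2 by rewrite h !inE eqxx ?orbT.
move: unq; rewrite /= !inE negb_or andbT => /andP[/andP[uw1 uw2] w12].
apply/setP=> x; rewrite in_sideC // in_setU1 in_setU; apply/idP/idP => [xu|].
  have [//|xv] := eqVneq x v.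
  have [w vw xw] := side_exists xv; move: vw; rewrite h !in_cons in_nil orbF.
  by case/or3P => /eqP e; rewrite e in xw; rewrite ?xw ?orbT //; case/negP: xu.
case/or3P=> [/eqP->|xw|xw]; apply/negP => xu.
- by move: (side_neq vu xu); rewrite eqxx.
- by rewrite (side_inj vu vw1 xu xw) eqxx in uw1.
- by rewrite (side_inj vu vw2 xu xw) eqxx in uw2.
Qed.

Lemma card_side_nbrs3 u v w1 w2 : nbrs v [:: u; w1; w2] ->
  #|side u v| = (#|side v w1| + #|side v w2|).+1.
Proof.
move=> hv; rewrite (side_nbrs3 hv); case: hv => unq h.
have vw1 : adj v w1 by rewrite h !inE eqxx ?orbT.
have vw2 : adj v w2 by rewrite h !inE eqxx ?orbT.
move: unq; rewrite /= !inE negb_or andbT => /andP[_ w12].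
have nv w : adj v w -> (v \in side v w) = false.
  by move=> vw; apply/negP => /(side_neq vw); rewrite eqxx.
rewrite cardsU1 in_setU !nv // cardsU.
have -> : side v w1 :&: side v w2 = set0.
  apply/setP=> x; rewrite [RHS]inE; apply/negP; rewrite inE => /andP[x1 x2].
  by rewrite (side_inj vw1 vw2 x1 x2) eqxx in w12.
by rewrite cards0 subn0.
Qed.

(* Connected vertex sets; in a tree they are the subtrees. *)
Definition within S a b := [&& adj a b, a \in S & b \in S].
Arguments within S a b /.
Definition conn S := [forall x in S, forall y in S, connect (within S) x y].

Lemma withinC S : connect_sym (within S).
Proof. by apply: sym_connect_sym => x y /=; rewrite adjC andbA andbAC -andbA. Qed.

Lemma connP S : reflect {in S &, forall x y, connect (within S) x y} (conn S).
Proof.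
apply: (iffP forall_inP) => [h x y xS yS|h x xS]; first by move/forall_inP: (h x xS); apply.
by apply/forall_inP => y; apply: h.
Qed.

Lemma conn_root S v : (forall x, x \in S -> connect (within S) v x) -> conn S.
Proof.
move=> h; apply/connP => x y xS yS; apply: connect_trans (h y yS).
by rewrite withinC h.
Qed.

Lemma connect_withinS S S' x y :
  S \subset S' -> connect (within S) x y -> connect (within S') x y.
Proof.
move=> /subsetP sub; apply: connect_sub => a b /and3P[ab aS bS].
by apply: connect1; apply/and3P; split; auto.
Qed.

Lemma conn_sub_side S v w w' :
  conn S -> v \notin S -> w \in S -> w \in side v w' -> S \subset side v w'.
Proof.
move=> /connP cS vS wS; rewrite inE => ww'; apply/subsetP => x xS; rewrite inE.
apply: connect_trans ww' _; apply: connect_sub (cS w x wS xS) => a b /and3P[ab aS bS].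
apply: connect1; apply/and3P; split => //.
  by apply: contraNneq vS => <-.
by apply: contraNneq vS => <-.
Qed.

(** A connected set through [v] can enter this side only by the edge [vw], so its trace there is
    connected and contains [w]. *)
Lemma conn_cap_side S v w x :
  conn S -> v \in S -> adj v w -> x \in S :&: side v w ->
  w \in S /\ connect (within (S :&: side v w)) w x.
Proof.
move=> /connP cS vS vw /setIP[xS xw].
have [w' /and3P[vw' _ w'S] c] := connect_first_step (cS v x vS xS) (side_neq vw xw).
have sub : subrel (connect (avoid (within S) v)) (connect (avoid adj v)).
  apply: connect_sub => a b /and3P[/and3P[ab _ _] av bv].
  by apply: connect1; apply/and3P.
have e : w' = w by apply: (side_inj vw' vw _ xw); rewrite inE; apply: sub.
rewrite e in w'S c; split=> //.
move/connect_inner: c; apply: connect_sub => a b /and3P[/and3P[/and3P[ab aS bS] _ _] /sub ca /sub cb].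
by apply: connect1; apply/and3P; rewrite !inE aS bS.
Qed.

(* The subtrees that contain [v] but not its neighbour [u]. *)
Definition rooted_conn u v : {set {set G}} :=
  [set S | [&& conn S, v \in S & u \notin S]].
Definition nrooted u v := #|rooted_conn u v|.

Lemma rooted_conn_side u v S : S \in rooted_conn u v -> S \subset side u v.
Proof.
rewrite inE => /and3P[cS vS uS]; exact: (conn_sub_side cS uS vS (side_refl _ _)).
Qed.

Lemma nrooted1 u v : nbrs v [:: u] -> nrooted u v = 1.
Proof.
move=> hv; have vu : adj v u by rewrite (proj2 hv) inE.
apply/eqP/cards1P; exists [set v]; apply/setP=> S; rewrite [RHS]inE.
apply/idP/eqP => [hS|->].
  apply/eqP; rewrite eqEsubset -{1}(side_nbrs1 hv) rooted_conn_side //=.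
  by rewrite sub1set; move: hS; rewrite inE => /and3P[].
rewrite !inE eqxx eq_sym (adj_neq vu) /= andbT; apply: (@conn_root _ v) => x.
by rewrite inE => /eqP ->; apply: connect0.
Qed.

(** Removing [v] leaves, on each of the other two sides, either nothing or a subtree rooted at the
    neighbour; the successors count the empty choices. *)
Lemma nrooted3 u v w1 w2 : nbrs v [:: u; w1; w2] ->
  nrooted u v = (nrooted v w1).+1 * (nrooted v w2).+1.
Proof.
move=> [unq h]; have vu : adj v u by rewrite h inE eqxx.
have vw1 : adj v w1 by rewrite h !inE eqxx ?orbT.
have vw2 : adj v w2 by rewrite h !inE eqxx ?orbT.
move: unq; rewrite /= !inE negb_or andbT => /andP[/andP[uw1 uw2] w12].
have dis w w' x : adj v w -> adj v w' -> w != w' -> x \in side v w -> (x \in side v w') = false.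
  by move=> vw vw' ne xw; apply/negP => xw'; rewrite (side_inj vw vw' xw xw') eqxx in ne.
have nv w : adj v w -> (v \in side v w) = false.
  by move=> vw; apply/negP => /(side_neq vw); rewrite eqxx.
pose Q w := set0 |: rooted_conn v w.
have cQ w : #|Q w| = (nrooted v w).+1 by rewrite cardsU1 !inE andbF.
have Qs w S : S \in Q w -> S \subset side v w.
  by case/setU1P => [->|]; [apply: sub0set|apply: rooted_conn_side].
rewrite -!cQ -cardsX.
pose psi (p : {set G} * {set G}) : {set G} := v |: (p.1 :|: p.2).
have psiK S1 S2 w w' : adj v w -> adj v w' -> w != w' ->
    S1 \subset side v w -> S2 \subset side v w' -> (v |: (S1 :|: S2)) :&: side v w = S1.
  move=> vw vw' ne /subsetP s1 /subsetP s2; apply/setP=> x; rewrite in_setI in_setU1 in_setU.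
  have [->|_] := eqVneq x v; first by rewrite nv // ; apply/esym/negP => /s1; rewrite nv.
  rewrite /=; apply/idP/idP => [/andP[/orP[//|/s2 xw'] xw]|xS1]; last by rewrite xS1 s1.
  by rewrite (dis _ _ _ vw vw' ne xw) in xw'.
have inj : {in setX (Q w1) (Q w2) &, injective psi}.
  move=> [S1 S2] [S1' S2'] /setXP[/Qs a /Qs b] /setXP[/Qs c /Qs d] /= e.
  congr pair.
    by rewrite -(psiK S1 S2 w1 w2) // -[in RHS](psiK S1' S2' w1 w2) // -[_ |: _]/(psi (S1, S2)) e.
  have w21 : w2 != w1 by rewrite eq_sym.
  rewrite -(psiK S2 S1 w2 w1) // -[in RHS](psiK S2' S1' w2 w1) //.
  by rewrite [S2 :|: S1]setUC [S2' :|: S1']setUC -[_ |: _]/(psi (S1, S2)) e.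
rewrite -(card_in_imset inj) /nrooted; congr #|pred_of_set _|.
apply/setP=> S; apply/idP/imsetP => [hS|[[S1 S2] /setXP[/= q1 q2] ->]].
  move: (hS); rewrite inE => /and3P[cS vS uS].
  exists (S :&: side v w1, S :&: side v w2).
    have key w : adj v w -> S :&: side v w \in Q w.
      move=> vw; apply/setU1P.
      have [e|/set0Pn[x xI]] := eqVneq (S :&: side v w) set0; [by left|right].
      have [wS _] := conn_cap_side cS vS vw xI.
      have r y yI : connect _ w y := proj2 (@conn_cap_side S v w y cS vS vw yI).
      rewrite inE (conn_root r) !in_setI wS side_refl nv // andbF.
      by [].
    by rewrite inE /= !key.
  rewrite /psi /= -setIUr; apply/setP=> x; rewrite in_setU1 in_setI in_setU.
  have [->//|xv] := eqVneq x v.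
  have [xS|//] := boolP (x \in S) => /=.
  have [w vw xw] := side_exists xv; move: (vw); rewrite h !in_cons in_nil orbF.
  case/or3P => /eqP e; rewrite e in xw; rewrite -/(side _ _).
  - have := subsetP (rooted_conn_side hS) _ xS; by rewrite in_sideC // xw.
  - by rewrite xw.
  - by rewrite xw orbT.
rewrite inE /psi /=; apply/and3P; split; last 1 first.
- rewrite !inE negb_or eq_sym (adj_neq vu) /= negb_or.
  have uu : u \in side v u := side_refl _ _.
  apply/andP; split; apply/negP.
    by move/(subsetP (Qs _ _ q1)); rewrite (dis u).
  by move/(subsetP (Qs _ _ q2)); rewrite (dis u).
- have sub1 : S1 \subset v |: (S1 :|: S2).
    by apply/subsetP => x xS; rewrite !inE xS orbT.
  have sub2 : S2 \subset v |: (S1 :|: S2).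
    by apply/subsetP => x xS; rewrite !inE xS !orbT.
  have key w S0 : adj v w -> S0 \subset v |: (S1 :|: S2) -> S0 \in Q w ->
      forall x, x \in S0 -> connect (within (v |: (S1 :|: S2))) v x.
    move=> vw sub /setU1P[->|hS] x xS; first by rewrite inE in xS.
    move: hS; rewrite inE => /and3P[/connP cS wS _].
    apply: (@connect_trans _ _ w); last exact: connect_withinS sub (cS _ _ wS xS).
    by apply: connect1; rewrite /= vw setU11 (subsetP sub).
  apply: (@conn_root _ v) => x; rewrite in_setU1 in_setU => /or3P[/eqP->|xS|xS].
  + exact: connect0.
  + exact: (key w1 S1).
  + exact: (key w2 S2).
- by rewrite setU11.
Qed.

(** Adding [v] is injective on the sets counted on the left, and [u] lies on another side of [v], so
    it is not contained. *)
Lemma nrooted_mono u v w : adj v u -> adj v w -> w != u -> nrooted v w <= nrooted u v.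
Proof.
move=> vu vw wu; rewrite /nrooted.
rewrite -(@card_in_imset _ _ (fun S => v |: S) (rooted_conn v w)); last first.
  move=> S S'; rewrite !inE => /and3P[_ _ vS] /and3P[_ _ vS'] e.
  by rewrite -(setU1K vS) e setU1K.
apply: subset_leq_card; apply/subsetP => _ /imsetP[S hS ->].
have sS := rooted_conn_side hS; move: hS; rewrite !inE eqxx => /and3P[/connP cS wS vS].
apply/and3P; split => //.
  apply: (@conn_root _ v) => x /setU1P[->|xS]; first exact: connect0.
  apply: (@connect_trans _ _ w); last exact: connect_withinS (subsetUr _ _) (cS _ _ wS xS).
  by apply: connect1; rewrite /= vw setU11 in_setU1 wS orbT.
rewrite negb_or eq_sym adj_neq //=; apply: contra wu => /(subsetP sS) uw.
by rewrite (side_inj vw vu uw (side_refl _ _)).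
Qed.

(** * Subtrees as connected vertex sets, and the subtree core *)

Lemma in_edges E : reflect (exists a b, adj a b /\ E = [set a; b]) (E \in edges G).
Proof.
apply: (iffP imsetP) => [[[a b]]|[a [b [ab ->]]]].
  by rewrite inE /= => ab ->; exists a, b.
by exists (a, b); rewrite ?inE.
Qed.

Lemma set2_edges a b : ([set a; b] \in edges G) = adj a b.
Proof.
apply/in_edges/idP => [[c [d [cd /eq_set2[[-> ->]|[-> ->]]]]]|ab] //.
  by rewrite adjC.
by exists a, b.
Qed.

Definition induced S : {set {set G}} := [set E in edges G | E \subset S].

Lemma set2_induced S a b : ([set a; b] \in induced S) = within S a b.
Proof. by rewrite inE set2_edges subUset !sub1set. Qed.

Lemma subtree_within (H : pregraph G) a b :
  subtree H -> [set a; b] \in H.2 -> within H.1 a b.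
Proof.
case/and3P=> /andP[/subsetP sub /forall_inP sub1] _ _ abH.
have := sub1 _ abH; rewrite subUset !sub1set => /andP[aH bH].
by rewrite /= aH bH -set2_edges sub.
Qed.

Lemma subtree_connect (H : pregraph G) a b :
  subtree H -> a \in H.1 -> b \in H.1 -> connect [rel a b | [set a; b] \in H.2] a b.
Proof. by case/and3P=> _ _ /forall_inP h /h/forall_inP; apply. Qed.

(** For an edge [ab] between vertices of a subtree, the first step [c] of the connection from [a] to
    [b] inside it has [b] on its side of [a], so [c = b]. Hence subtrees can be counted by vertex
    sets. *)
Lemma subtree_conn (H : pregraph G) : subtree H -> conn H.1 /\ H.2 = induced H.1.
Proof.
move=> sH; split.
  apply/connP => a b aH bH; apply: connect_sub (subtree_connect sH aH bH) => c d /= cd.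
  by apply: connect1; apply: subtree_within.
apply/setP=> E; apply/idP/idP => [EH|].
  case/and3P: (sH) => /andP[/subsetP sub /forall_inP sub1] _ _.
  by rewrite inE sub // sub1.
rewrite inE => /andP[/in_edges[a [b [ab ->]]]]; rewrite subUset !sub1set => /andP[aH bH].
have [|c acH cb] := connect_first_step (subtree_connect sH aH bH).
  by rewrite eq_sym adj_neq.
suff -> : b = c by [].
have /and3P[ac _ _] := subtree_within sH acH.
apply: (side_inj ab ac (side_refl _ _)); rewrite inE.
apply: connect_sub cb => x y /and3P[/(subtree_within sH)/and3P[xy _ _] xa ya].
by apply: connect1; apply/and3P.
Qed.

Lemma conn_subtree S : S != set0 -> conn S -> subtree (S, induced S).
Proof.
move=> S0 /connP cS; apply/and3P; split => //=.
  apply/andP; split; first by apply/subsetP => E; rewrite inE => /andP[].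
  by apply/forall_inP => E; rewrite inE => /andP[].
apply/forall_inP => x xS; apply/forall_inP => y yS.
apply: connect_sub (cS x y xS yS) => a b ab; apply: connect1.
by rewrite /= set2_induced.
Qed.

Lemma nb_subtreesE v : nb_subtrees v = #|[set S : {set G} | conn S && (v \in S)]|.
Proof.
rewrite /nb_subtrees -(@card_imset _ _ (fun S => (S, induced S))); last by move=> S S' [].
congr #|pred_of_set _|; apply/setP=> -[S F]; rewrite inE /=.
apply/andP/imsetP => [[/subtree_conn[/= cS ->] vS]|[S']].
  by exists S; rewrite ?inE ?cS.
rewrite inE => /andP[cS vS] [-> ->]; split=> //; apply: conn_subtree => //.
by apply/set0Pn; exists v.
Qed.

(** The subtrees containing both ends are common to the two counts; each [nrooted] term counts those
    that contain just one end. *)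
Lemma nb_subtrees_edge u v : adj u v ->
  nb_subtrees u + nrooted u v = nb_subtrees v + nrooted v u.
Proof.
move=> uv; rewrite !nb_subtreesE.
rewrite -(cardsID [set S : {set G} | v \in S] [set S : {set G} | conn S && (u \in S)]).
rewrite -(cardsID [set S : {set G} | u \in S] [set S : {set G} | conn S && (v \in S)]).
have -> : [set S : {set G} | conn S && (u \in S)] :&: [set S : {set G} | v \in S] =
          [set S : {set G} | conn S && (v \in S)] :&: [set S : {set G} | u \in S].
  by apply/setP=> S; rewrite !inE -!andbA [(u \in S) && _]andbC.
have E x y : [set S : {set G} | conn S && (x \in S)] :\: [set S : {set G} | y \in S] = rooted_conn y x.
  by apply/setP=> S; rewrite !inE andbC -andbA.
by rewrite !E /nrooted addnAC.
Qed.

(** Unimodality: once an edge does not increase the count, [nrooted_mono] at both of its ends hands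
    the same comparison to the next edge of the path. *)
Lemma nb_subtrees_walk p a b : adj a b -> path adj a p -> uniq (b :: a :: p) ->
  nrooted b a <= nrooted a b -> nb_subtrees (last a p) <= nb_subtrees a.
Proof.
elim: p a b => [//|c p IH] a b ab /= /andP[ac pth].
rewrite !inE !negb_or => /and4P[/and3P[ba bc bp] /andP[nac ap] cp up] le.
have m1 : nrooted a b <= nrooted c a by apply: nrooted_mono => //.
have m2 : nrooted a c <= nrooted b a by apply: nrooted_mono; rewrite // eq_sym.
have e := nb_subtrees_edge ac.
have m : nrooted a c <= nrooted c a := leq_trans m2 (leq_trans le m1).
have h : nb_subtrees c <= nb_subtrees a.
  by rewrite -(leq_add2r (nrooted c a)) -e leq_add2l.
apply: leq_trans h; apply: (IH c a) => //.
  by rewrite adjC.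
by rewrite /= inE negb_or nac ap cp up.
Qed.

Lemma nb_subtrees_side u v x : adj u v -> nrooted v u < nrooted u v ->
  x \in side v u -> nb_subtrees x < nb_subtrees v.
Proof.
move=> uv lt xu; have e := nb_subtrees_edge uv.
suff : nb_subtrees x <= nb_subtrees u by lia.
move: xu; rewrite inE => /connectP[p + ->] => pth.
case/shortenP: pth => {}p /avoid_pathW[pth vp] unq _.
apply: (nb_subtrees_walk uv pth); last exact: ltnW.
by rewrite [uniq _]/= in_cons negb_or eq_sym adj_neq //= vp.
Qed.

Lemma core_side u v x : adj u v -> nrooted v u < nrooted u v ->
  x \in subtree_core G -> x \in side u v.
Proof.
move=> uv lt; rewrite inE => /forallP/(_ v) le.
rewrite in_sideC 1?adjC //; apply/negP => /(nb_subtrees_side uv lt); lia.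
Qed.

Lemma core_edge u v : adj u v -> v \in subtree_core G -> u \notin subtree_core G ->
  nrooted v u < nrooted u v.
Proof.
move=> uv; rewrite !inE => /forallP vc /forallPn[w]; rewrite -ltnNge => lt.
have := vc w; have := nb_subtrees_edge uv; lia.
Qed.

(** * Branches, weights and the centroid *)

Definition toward v x := odflt x [pick p | adj x p && (v \in side x p)].

Lemma towardP v x : x != v -> adj x (toward v x) /\ v \in side x (toward v x).
Proof.
rewrite eq_sym => /side_exists[p xp vp]; rewrite /toward.
by case: pickP => [q /andP[]//|/(_ p)]; rewrite xp vp.
Qed.

Lemma toward_eq v x p : adj x p -> v \in side x p -> toward v x = p.
Proof.
move=> xp vp; have [] := @towardP v x; last by move=> h1 h2; apply: side_inj vp.
by rewrite eq_sym; apply: side_neq vp.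
Qed.

(** With the tree rooted at [v], every other vertex owns the edge to its parent; this turns edge
    counts of branches into vertex counts of sides. *)
Lemma set2_toward_inj v : {in [set~ v] &, injective (fun x => [set x; toward v x])}.
Proof.
move=> x y; rewrite !inE => xv yv /eq_set2[[]//|[e1 e2]].
have [xp vx] := towardP xv; have [_ vy] := towardP yv.
by move: vy; rewrite -e1; rewrite e2 in xp vx; rewrite in_sideC // vx.
Qed.

Lemma adj_toward v a b : adj a b ->
  (a != v /\ b = toward v a) \/ (b != v /\ a = toward v b).
Proof.
move=> ab; have ba : adj b a by rewrite adjC.
have [h|h] := boolP (v \in side a b); [left|right].
  by rewrite (toward_eq ab h) eq_sym; split=> //; apply: side_neq h.
by rewrite -in_sideC // in h; rewrite (toward_eq ba h) eq_sym; split=> //; apply: side_neq h.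
Qed.

(** The single edge of a branch at [v] leads to some [w], which confines the rest of the branch to
    the side of [w]; each edge of the branch is then owned by a vertex of that side. *)
Lemma weight_le v m : (forall w, adj v w -> #|side v w| <= m) -> weight v <= m.
Proof.
move=> h; apply/bigmax_leqP => H /and3P[sH /andP[vH /cards1P[E0 hE0]] _].
have : E0 \in [set E0] by rewrite inE.
rewrite -hE0 inE => /andP[E0H vE0].
have hsub : {in H.1, forall x, x != v -> exists2 w, x \in side v w & [set v; w] \in H.2}.
  move=> x xH xv; have [w vw c] := connect_first_step (subtree_connect sH vH xH) xv.
  exists w => //; rewrite inE; apply: connect_sub c => a b /and3P[/(subtree_within sH)/and3P[ab _ _] av bv].
  by apply: connect1; apply/and3P.
have [w vw eE] : exists2 w, adj v w & E0 = [set v; w].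
  have : E0 \in edges G by case/and3P: sH => /andP[/subsetP sub _] _ _; apply: sub.
  case/in_edges=> a [b [ab e]]; move: vE0; rewrite e !inE => /orP[]/eqP ev.
    by exists b; rewrite ev.
  by exists a; rewrite ev 1?adjC // setUC.
apply: leq_trans (h w vw).
apply: (@leq_trans #|[set [set x; toward v x] | x in side v w]|); last exact: leq_imset_card.
apply: subset_leq_card; apply/subsetP => E EH.
have Eed : E \in edges G by case/and3P: sH => /andP[/subsetP sub _] _ _; apply: sub.
case/in_edges: Eed => a [b [ab eE']]; rewrite eE' in EH *.
have /and3P[_ aH bH] := subtree_within sH EH.
have key x : x \in H.1 -> x != v -> x \in side v w.
  move=> xH xv; have [w' xw' w'H] := hsub x xH xv.
  have : [set v; w'] \in [set E in H.2 | v \in E] by rewrite inE w'H !inE eqxx.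
  rewrite hE0 inE eE => /eqP/eq_set2[[_ <-]//|[ew _]].
  by have := adj_neq vw; rewrite ew eqxx.
case: (adj_toward v ab) => -[nv ->]; apply/imsetP; first by exists a; rewrite ?key.
by exists b; rewrite ?key // setUC.
Qed.

(** The side of [w] with [v] attached is a subtree with [v] pendant and the right number of edges. A
    largest such subtree above it is a branch, with at least as many edges. *)
Lemma weight_ge v w : adj v w -> #|side v w| <= weight v.
Proof.
move=> vw; set V := v |: side v w.
pose H : pregraph G := (V, [set [set x; toward v x] | x in side v w]).
have vS : v \notin side v w by apply/negP => /(side_neq vw); rewrite eqxx.
have sub : {subset side v w <= [set~ v]}.
  by move=> x xw; rewrite in_setC1; apply: side_neq xw.
have cH : #|H.2| = #|side v w|.
  by apply: card_in_imset; apply: sub_in2 (@set2_toward_inj v).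
have tV x : x \in side v w -> toward v x \in V.
  move=> xw; have xv := side_neq vw xw; have [xt _] := towardP xv.
  rewrite in_setU1; case: eqVneq => //= tv; exact: side_step xw xt xv tv.
have adjH a b : adj a b -> a \in V -> b \in V -> [set a; b] \in H.2.
  move=> ab aV bV; case: (adj_toward v ab) => -[nv ->]; apply/imsetP.
    by exists a => //; move: aV; rewrite in_setU1 (negPf nv).
  by exists b; [move: bV; rewrite in_setU1 (negPf nv)|rewrite setUC].
have sH : subtree H.
  apply/and3P; split.
  - apply/andP; split; last first.
      apply/forall_inP => _ /imsetP[x xw ->]; rewrite subUset !sub1set tV //.
      by rewrite in_setU1 xw orbT.
    apply/subsetP => _ /imsetP[x xw ->]; rewrite set2_edges.
    by have [] := towardP (side_neq vw xw).
  - by apply/set0Pn; exists v; rewrite in_setU1 eqxx.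
  have root x : x \in V -> connect [rel a b | [set a; b] \in H.2] v x.
    have cvw : connect [rel a b | [set a; b] \in H.2] v w.
      apply: connect1; apply: adjH => //; first exact: setU11.
      by apply/setU1P; right; apply: side_refl.
    case/setU1P => [->|xw]; first exact: connect0.
    apply: connect_trans cvw _; move: xw; rewrite inE => /connect_inner.
    apply: connect_sub => a b /and3P[/and3P[ab _ _] ca cb]; apply: connect1.
    by apply: adjH => //; apply/setU1P; right; rewrite inE.
  apply/forall_inP => x /root cx; apply/forall_inP => y /root cy.
  apply: connect_trans cy; rewrite sym_connect_sym // => a b /=.
  by rewrite setUC.
have pH : pendant_in v H.
  rewrite /pendant_in setU11 /=; apply/cards1P; exists [set w; v].
  apply/setP=> E; rewrite [RHS]inE inE; apply/andP/eqP => [[/imsetP[x xw ->]]|->].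
    rewrite !inE eq_sym (negPf (side_neq vw xw)) /= => /eqP e.
    have [xv _] := towardP (side_neq vw xw); rewrite -e in xv *; rewrite adjC in xv.
    by rewrite (side_inj xv vw (side_refl _ _) xw).
  rewrite !inE eqxx orbT; split=> //.
  apply: adjH; rewrite ?setU11 1?adjC //; apply/setU1P; right; exact: side_refl.
pose P (K : pregraph G) := [&& subtree K, pendant_in v K & subgraph_le H K].
have PH : P H by rewrite /P sH pH /subgraph_le !subxx.
case: (arg_maxnP (fun K : pregraph G => #|K.1| + #|K.2|) PH) => K /and3P[sK pK HK] maxK.
rewrite -cH; apply: (@leq_trans #|K.2|).
  by apply: subset_leq_card; case/andP: HK.
apply: (@leq_bigmax_cond _ _ (fun K : pregraph G => #|K.2|)).
apply/and3P; split=> //; apply/forallP => K'; apply/implyP => /and3P[sK' pK' /andP[l1 l2]].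
have /maxK /= : P K'.
  rewrite /P sK' pK' /=; case/andP: HK => k1 k2.
  by rewrite /subgraph_le (subset_trans k1 l1) (subset_trans k2 l2).
have c1 := subset_leq_card l1; have c2 := subset_leq_card l2 => le.
have e1 : K.1 = K'.1.
  by apply/eqP; rewrite eqEcard l1 -(leq_add2r #|K'.2|) (leq_trans le) ?leq_add2l.
have e2 : K.2 = K'.2.
  by apply/eqP; rewrite eqEcard l2 -(leq_add2l #|K'.1|) (leq_trans le) ?leq_add2r.
by case: K K' e1 e2 {maxK sK pK HK sK' pK' l1 l2 c1 c2 le} => [a1 a2] [b1 b2] /= -> ->.
Qed.

Lemma card_side_step u v w : adj v u -> adj v w -> w != u -> #|side v w| < #|side u v|.
Proof.
move=> vu vw wu; apply: proper_card; apply/properP; split.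
  apply/subsetP => x xw; rewrite in_sideC //; apply/negP => xu.
  by rewrite (side_inj vw vu xw xu) eqxx in wu.
exists v; first exact: side_refl.
by apply/negP => /(side_neq vw); rewrite eqxx.
Qed.

Lemma side_sub u v w x : adj u v -> x \in side v u -> adj x w -> v \in side x w ->
  side u v \subset side x w.
Proof.
move=> uv xu xw vw; apply/subsetP => y yu; have vu : adj v u by rewrite adjC.
move: (vw); rewrite !inE => c; apply: connect_trans c _.
move: yu; rewrite inE => /connect_inner; apply: connect_sub => a b.
have nx z : connect (avoid adj u) v z -> z != x.
  move=> cz; have zu : z \in side u v by rewrite inE.
  by apply: contraTneq xu => <-; rewrite in_sideC // zu.
by case/and3P=> /and3P[ab _ _] ca cb; apply: connect1; apply/and3P; rewrite !nx.
Qed.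

(** From a vertex on the smaller side, a single branch contains the whole larger side, whereas a
    branch at [v] leads either to the smaller side or to a proper part of the larger one. *)
Lemma centroid_side u v x : adj u v -> #|side v u| < #|side u v| ->
  x \in centroid G -> x \in side u v.
Proof.
move=> uv lt; have vu : adj v u by rewrite adjC.
rewrite inE => /forallP/(_ v) le; rewrite in_sideC //; apply/negP => xu.
have xv : v != x by rewrite eq_sym; apply: side_neq xu.
have [w xw vw] := side_exists xv.
have l1 := weight_ge xw; have l2 := subset_leq_card (side_sub uv xu xw vw).
suff : weight v < weight x by lia.
apply: (@leq_trans #|side u v|); last by apply: leq_trans l1.
have s0 := side_gt0 u v; rewrite -(ltn_predK s0) ltnS.
apply: weight_le => z vz; rewrite -ltnS (ltn_predK s0).
have [->//|zu] := eqVneq z u; exact: card_side_step.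
Qed.

Lemma centroid_edge u v : adj u v -> u \in centroid G -> v \notin centroid G ->
  #|side u v| < #|side v u|.
Proof.
move=> uv; have vu : adj v u by rewrite adjC.
rewrite !inE => /forallP uc /forallPn[w]; rewrite -ltnNge => lt; rewrite ltnNge.
apply/negP => le; have := uc w; suff : weight v <= weight u by lia.
have l1 := weight_ge uv; apply: weight_le => z vz; have [->|zu] := eqVneq z u; first lia.
have := card_side_step vu vz zu; lia.
Qed.

(** Meant for explicit trees: a side is recognized by the single edge that leaves it. *)
Lemma side_cut u v S : adj u v -> v \in S -> u \notin S ->
  (forall a b, adj a b -> a \in S -> b \notin S -> a = v /\ b = u) -> side u v = S.
Proof.
move=> uv vS uS cut; have vu : adj v u by rewrite adjC.
have closed e x y (A : {set G}) : connect e x y -> x \in A ->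
    (forall a b, e a b -> a \in A -> b \in A) -> y \in A.
  move=> /connectP[p + ->] + cl; elim: p x => //= z p IH x /andP[xz pth] xA.
  by apply: IH pth _; apply: cl xz xA.
apply/setP=> x; apply/idP/idP.
  rewrite inE => c; apply: closed c vS _ => a b /and3P[ab au bu] aS.
  by apply: contraTT bu => bS; have [_ ->] := cut a b ab aS bS; rewrite eqxx.
apply: contraTT; rewrite -in_sideC // inE => c; rewrite -in_setC; apply: closed c _ _.
  by rewrite inE.
move=> a b /and3P[ab av bv]; rewrite !inE => aS; apply: contra bv => bS.
by rewrite adjC in ab; have [->] := cut b a ab bS aS.
Qed.
End Tree.

(** * Distances and binary trees *)

Lemma leq_bigmin (I : finType) (P : pred I) (F : I -> nat) m k :
  k <= m -> (forall i, P i -> k <= F i) -> k <= \big[minn/m]_(i | P i) F i.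
Proof. by move=> km h; elim/big_rec: _ => // i x Pi kx; rewrite leq_min h. Qed.

Lemma bigmin_leq (I : finType) (P : pred I) (F : I -> nat) m i :
  P i -> \big[minn/m]_(i | P i) F i <= F i.
Proof.
move=> Pi; have := mem_index_enum i; elim: (index_enum I) => // j s IH.
rewrite inE big_cons => /orP[/eqP <-|/IH le]; first by rewrite Pi geq_minl.
by case: ifP => // _; rewrite geq_min le orbT.
Qed.

Section Distance.
Variable G : graph.
Implicit Types (x y : G) (X Y : {set G}).

Lemma dist_le x y p : path (@adj G) x p -> last x p = y -> dist x y <= size p.
Proof.
move=> pth lst; have [lt|ge] := ltnP (size p) #|G|.
  apply: (@bigmin_leq _ _ (fun k : 'I_#|G| => k : nat) _ (Ordinal lt)) => /=.
  by apply/existsP; exists (in_tuple p); rewrite /= pth lst eqxx.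
apply: leq_trans ge; rewrite /dist; elim/big_rec: _ => // i z _ le.
by rewrite geq_min le orbT.
Qed.

(** The bound on [k] reflects the default value [#|G|] in the definition of [dist]. *)
Lemma dist_ge x y k : k <= #|G| ->
  (forall p, path (@adj G) x p -> last x p = y -> k <= size p) -> k <= dist x y.
Proof.
move=> km h; apply: leq_bigmin => // i /existsP[p /andP[pth /eqP e]].
by rewrite -(size_tuple p); apply: h.
Qed.

Lemma dist_path x y : connect (@adj G) x y ->
  exists p, [/\ path (@adj G) x p, last x p = y & size p = dist x y].
Proof.
case/connectP=> q pth0 ->; case/shortenP: pth0 => {}q pth0 unq _.
have lt : size q < #|G| by have := max_card (mem (x :: q)); rewrite (card_uniqP unq).
pose Q (k : 'I_#|G|) := [exists p : k.-tuple G, path (@adj G) x p && (last x p == last x q)].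
have Q0 : Q (Ordinal lt).
  by apply/existsP; exists (in_tuple q); rewrite /= pth0 eqxx.
case: (@arg_minnP _ _ Q (fun k => k) Q0) => k Qk mink.
case/existsP: (Qk) => p /andP[pth /eqP lst]; exists p; split=> //.
apply/eqP; rewrite eqn_leq dist_le // andbT size_tuple.
by apply: leq_bigmin => [|i /mink//]; apply: ltnW.
Qed.

Lemma dist_uniq_path x y : connect (@adj G) x y ->
  exists p, [/\ path (@adj G) x p, last x p = y, uniq (x :: p) & size p = dist x y].
Proof.
case/dist_path=> p [+ + e]; case/shortenP => q pth unq sub lst.
exists q; split=> //; apply/eqP; rewrite eqn_leq dist_le // andbT -e.
by apply: uniq_leq_size => //; case/andP: unq.
Qed.

Lemma set_dist_le X Y x y : x \in X -> y \in Y -> set_dist X Y <= dist x y.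
Proof.
move=> xX yY; apply: leq_trans (bigmin_leq _ _ xX) _.
exact: (bigmin_leq (dist x)).
Qed.

Lemma set_dist_ge X Y k : k <= #|G| -> {in X & Y, forall x y, k <= dist x y} ->
  k <= set_dist X Y.
Proof. by move=> km h; do 2!apply: leq_bigmin => // ? ?; apply: h. Qed.

Lemma dist_ge_lipschitz (f : G -> nat) x y :
  (forall a b, adj a b -> f b <= (f a).+1) -> f y - f x <= #|G| -> f y - f x <= dist x y.
Proof.
move=> lip km; apply: dist_ge km _ => p pth <- {y}; rewrite leq_subLR.
elim: p x pth => [|z p IH] x /=; first by rewrite addn0.
case/andP=> /lip xz /IH le; apply: leq_trans le _.
by rewrite addnS -addSn leq_add2r.
Qed.

Lemma dist_le_potential (f : G -> nat) y :
  (forall x, x != y -> exists2 z, adj x z & f z < f x) -> forall x, dist x y <= f x.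
Proof.
move=> h x; have [p [pth lst le]] : exists p, [/\ path (@adj G) x p, last x p = y & size p <= f x].
  have [n le] := ubnP (f x); elim: n x le => // n IH x le.
  have [->|xy] := eqVneq x y; first by exists [::].
  have [z xz lt] := h x xy; have [|p [pth lst sz]] := IH z; first exact: leq_trans lt _.
  by exists (z :: p); rewrite /= xz (leq_ltn_trans sz).
exact: leq_trans (dist_le pth lst) le.
Qed.

End Distance.

Section Binary.
Variable G : graph.
Hypothesis binG : binary_tree G.
Implicit Types (u v w x y a b : G).
Let treeG : tree G := proj1 binG.
Notation adj := (@adj G).

Lemma binary_nbrs u v : adj v u ->
  nbrs v [:: u] \/ exists w1 w2, nbrs v [:: u; w1; w2].
Proof.
move=> vu; have uN : u \in [set w | adj v w] by rewrite inE.
have [/cards1P[u' e]|/(proj2 binG)] := boolP (pendant v).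
  left; split=> // x; have := in_set (adj v) x; rewrite e => <-.
  by move: uN; rewrite e !inE => /eqP ->.
rewrite /deg (cardsD1 u) uN add1n => /eqP; rewrite eqSS => /cards2P[w1 [w2 [ne e]]].
right; exists w1, w2; have /setP h := e; split.
  have := h w1; have := h w2; rewrite !inE !eqxx orbT /= => /andP[w2u _] /andP[w1u _].
  by rewrite !inE negb_or [u == w1]eq_sym [u == w2]eq_sym w1u w2u ne.
move=> x; have := h x; rewrite !inE; case: eqVneq => [->|] //=.
Qed.

(** Here [k] is the number of leaves on the side; the step from two sides to the one that joins them
    is [hcat_add] and [hopt_opt]. *)
Lemma binary_side u v : adj u v -> exists k, [/\ 0 < k, #|side u v| = k.*2.-1,
  hcat k <= (nrooted u v).+1 & (nrooted u v).+1 <= hopt k].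
Proof.
have [n le] := ubnP #|side u v|; elim: n u v le => // n IH u v le uv.
have vu : adj v u by rewrite adj_sym.
case: (binary_nbrs vu) => [h|[w1 [w2 h]]].
  by exists 1; rewrite (side_nbrs1 treeG h) (nrooted1 treeG h) cards1.
have := h; case=> unq hn.
have vw1 : adj v w1 by rewrite hn !inE eqxx ?orbT.
have vw2 : adj v w2 by rewrite hn !inE eqxx ?orbT.
have e := card_side_nbrs3 treeG h.
have [|k1 [k10 e1 l1 u1]] := IH v w1 _ vw1.
  by rewrite -ltnS; apply: leq_trans le; rewrite e ltnS ltnS leq_addr.
have [|k2 [k20 e2 l2 u2]] := IH v w2 _ vw2.
  by rewrite -ltnS; apply: leq_trans le; rewrite e ltnS ltnS leq_addl.
exists (k1 + k2); rewrite (nrooted3 treeG h) e e1 e2.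
have o := hopt_opt k10 k20; have c := hcat_add k10 k20.
split; [lia|lia| |].
  by apply: leq_trans c _; rewrite ltnS; apply: leq_mul.
by apply: leq_ltn_trans o; apply: leq_mul.
Qed.

(** Each step drops the vertex just passed and the nonempty side of its third neighbour, hence at
    least two vertices. The path [q] stops one vertex earlier, and so bounds the distance to
    [a']. *)
Lemma side_path a b p : adj a b -> path adj b p -> uniq (a :: b :: p) ->
  exists a' q, [/\ adj a' (last b p), path adj a q, last a q = a', size q = size p &
    #|side a' (last b p)| + (size p).*2 <= #|side a b|].
Proof.
elim: p a b => [|c p IH] a b ab /=.
  by move=> _ _; exists a, [::]; rewrite addn0.
case/andP=> bc pth /andP[]; rewrite !inE !negb_or => /and3P[_ ac ap] unq.
have [a' [q [h1 h2 h3 h4 h5]]] := IH b c bc pth (ltac:(by rewrite /= in_cons negb_or)).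
exists a', (b :: q); split; rewrite //= ?ab ?h4 //.
have ba : adj b a by rewrite adj_sym.
have [[_ hn]|[w1 [w2 hn]]] := binary_nbrs ba.
  by move: bc ac; rewrite hn inE => /eqP ->; rewrite eqxx.
have := card_side_nbrs3 treeG hn.
have s1 := side_gt0 b w1; have s2 := side_gt0 b w2.
case: hn => _ hn; move: bc; rewrite hn !inE eq_sym (negPf ac) /= => /orP[] /eqP ec;
  rewrite ec in h5 *; move: s1 s2 h5; move: #|side b w1| #|side b w2| #|side a b| #|side _ _| (size p); clear; lia.
Qed.

Lemma binary_dist x y : x \in centroid G -> y \in subtree_core G ->
  0 < dist x y -> {in centroid G & subtree_core G, forall x' y', dist x y <= dist x' y'} ->
  exists k1 k2, [/\ 0 < k1, 0 < k2, (k1 + k2).*2 = #|G|.+2,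
    hcat k2 < hopt k1 & (k1.*2.-1 + (dist x y).-1.*2).*2 < #|G|].
Proof.
move=> xc ys d0 dmin.
have [p [pth lst unq sz]] := dist_uniq_path (proj2 (proj1 treeG) x y).
case: p pth lst unq sz => [|b p] /= ; first by move=> _ _ _ sz; rewrite -sz in d0.
case/andP=> xb pth lst unq sz.
have [a [q [ay pthq lq sq szs]]] := side_path xb pth unq; rewrite lst in ay szs.
(* By minimality of the distance, neither the second vertex of the path can be in the centroid nor
   the last but one in the core. *)
have bc : b \notin centroid G.
  apply/negP => /dmin/(_ ys); rewrite -sz leqNgt ltnS => /negP; apply.
  exact: dist_le.
have ac : a \notin subtree_core G.
  apply/negP => /(dmin _ _ xc); rewrite -sz leqNgt ltnS => /negP; apply.
  by rewrite -sq; apply: dist_le.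
have lt1 := centroid_edge treeG xb xc bc.
have lt2 := core_edge treeG ay ys ac.
have [k1 [k10 e1 _ u1]] := binary_side ay.
have ya : adj y a by rewrite adj_sym.
have [k2 [k20 e2 l2 _]] := binary_side ya.
have c1 := card_sideC treeG xb; have c2 := card_sideC treeG ay.
exists k1, k2; rewrite -sz /=; split=> //.
- by rewrite -c2 e1 e2; move: k10 k20; clear; lia.
- exact: leq_ltn_trans l2 (leq_trans _ u1).
- rewrite e1 in szs; rewrite -c1; move: szs lt1; move: #|side x b| #|side b x| (size p); clear; lia.
Qed.

End Binary.

(** * The crg trees *)

Definition ptree_adj (par : nat -> nat) i j :=
  (0 < j) && (i == par j) || (0 < i) && (j == par i).

Section ParentTree.
Variable par : nat -> nat.
Hypothesis par_lt : forall i, 0 < i -> par i < i.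
Variable N : nat.

Let ord_adj : rel 'I_N.+1 := fun i j => ptree_adj par i j.

Lemma ptree_sym : symmetric ord_adj.
Proof. by move=> i j; rewrite /ord_adj /ptree_adj orbC. Qed.

Lemma ptree_irr : irreflexive ord_adj.
Proof.
move=> i; rewrite /ord_adj /ptree_adj orbb; apply/negP => /andP[i0 /eqP e].
by have := par_lt i0; rewrite -e ltnn.
Qed.

Definition ptree : graph := Graph ptree_sym ptree_irr.

Lemma ptree_adjE (x y : ptree) : adj x y = ptree_adj par x y.
Proof. by []. Qed.

Lemma ptree_adj_lt (x y : 'I_N.+1) : x < y -> ord_adj y x -> x = par y :> nat.
Proof.
move=> lt /orP[/andP[x0 /eqP e]|/andP[_ /eqP//]].
by have := par_lt x0; rewrite -e ltnNge ltnW.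
Qed.

(** [dp] stands for any depth function; quantifying over it inside lets one path serve both
    connectedness and distances. *)
Lemma ptree_path0 (x : ptree) : exists p,
  [/\ path (@adj ptree) ord0 p, last ord0 p = x &
   forall dp, dp 0 = 0 -> (forall i, 0 < i -> dp i = (dp (par i)).+1) -> size p = dp x].
Proof.
case: x => [i]; elim/ltn_ind: i => i IH lt.
have [i0|i0] := posnP i.
  exists [::]; split=> //; first by apply/val_inj; rewrite /= i0.
  by move=> dp d0 _; rewrite /= i0 d0.
have lt' : par i < N.+1 by apply: ltn_trans lt; apply: par_lt.
have [p [pth lst sz]] := IH _ (par_lt i0) lt'.
exists (rcons p (Ordinal lt)); rewrite last_rcons rcons_path pth lst; split=> //.
  by rewrite /= /ord_adj /ptree_adj /= i0 eqxx.
by move=> dp d0 dS; rewrite size_rcons (sz dp) // [RHS]dS.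
Qed.

Lemma ptree_connected : connected_graph ptree.
Proof.
split; first by rewrite card_ord.
have c0 x : connect (@adj ptree) ord0 x.
  by have [p [pth lst _]] := ptree_path0 x; apply/connectP; exists p.
move=> x y; apply: connect_trans (c0 y); rewrite sym_connect_sym //.
exact: adj_sym.
Qed.

(* The largest vertex of a cycle would have two parents. *)
Lemma ptree_acyclic : acyclic ptree.
Proof.
case=> [//|x0 c0] uc; rewrite leqNgt; apply/negP => sz.
have P0 : x0 \in x0 :: c0 by apply: mem_head.
case: (@arg_maxnP _ x0 [in x0 :: c0] (fun x : 'I_N.+1 => x) P0) => x xc maxx.
have [i c e] := rot_to xc; rewrite -(rot_ucycle i) e in uc.
rewrite -(size_rot i) e in sz.
have {}maxx y : y \in x :: c -> y <= x by rewrite -e mem_rot; apply: maxx.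
case: c uc sz maxx {e} => [//|y c]; case/lastP: c => [//|c z].
rewrite /ucycle /= !rcons_path last_rcons.
case/andP=> /and3P[xy _ zx] /and3P[xc' yc _] _ maxx.
have lt w : w \in y :: rcons c z -> w < x.
  move=> wc; rewrite ltn_neqAle; apply/andP; split; last by apply: maxx; rewrite inE wc orbT.
  by apply: contraNneq xc' => /ord_inj <-.
have yin : y \in y :: rcons c z by apply: mem_head.
have zin : z \in y :: rcons c z by rewrite inE mem_rcons mem_head orbT.
have ey := ptree_adj_lt (lt _ yin) xy.
rewrite ptree_sym in zx; have ez := ptree_adj_lt (lt _ zin) zx.
have : y = z by apply: ord_inj; rewrite ey ez.
by move=> eyz; rewrite eyz mem_rcons mem_head in yc.
Qed.

Lemma ptree_tree : tree ptree.
Proof. split; [exact: ptree_connected|exact: ptree_acyclic]. Qed.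

Lemma ptree_dist0 (dp : nat -> nat) (x : ptree) :
  dp 0 = 0 -> (forall i, 0 < i -> dp i = (dp (par i)).+1) -> dist (ord0 : ptree) x = dp x.
Proof.
move=> d0 dS; have [p [pth lst /(_ dp d0 dS) sz]] := ptree_path0 x.
apply/eqP; rewrite eqn_leq -{1}sz dist_le //=.
have le i : dp i <= i.
  elim/ltn_ind: i => i IH; have [->|i0] := posnP i; first by rewrite d0.
  by rewrite dS // (leq_ltn_trans (IH _ (par_lt i0))) ?par_lt.
have h : dp x - dp 0 = dp x by rewrite d0 subn0.
rewrite -h; apply: (@dist_ge_lipschitz ptree (fun y : 'I_N.+1 => dp y) ord0 x).
  move=> a b /orP[/andP[b0 /eqP e]|/andP[a0 /eqP e]]; first by rewrite (dS b) // e.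
  by rewrite (dS a) // e leqW.
by rewrite h card_ord (leq_trans (le x)) // ltnW.
Qed.

Lemma ptree_nbrs i (s : seq nat) : i <= N -> all (fun j => j <= N) s -> uniq s ->
  (forall j, j <= N -> ptree_adj par i j = (j \in s)) ->
  @nbrs ptree (inord i) (map inord s).
Proof.
move=> iN /allP sN us h; split.
  rewrite map_inj_in_uniq // => a b /sN aN /sN bN /(congr1 val) /=.
  by rewrite !inordK.
move=> x; rewrite /= /ord_adj inordK // h; last by rewrite -ltnS.
apply/idP/mapP => [xs|[j js ->]]; first by exists (x : nat) => //; rewrite inord_val.
by rewrite inordK // ltnS sN.
Qed.

(** Vertices after [i] hang on [i] or on later ones, so the edge from [i] to its parent is the only
    one leaving the initial segment. *)
Lemma ptree_cut i : 0 < i -> i <= N -> (forall j, i < j -> i <= par j) ->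
  @side ptree (inord i) (inord (par i)) = [set x : 'I_N.+1 | x < i].
Proof.
move=> i0 iN cut; have pi := par_lt i0.
have pN : par i < N.+1 by apply: ltn_trans pi _.
apply: (side_cut ptree_tree); rewrite ?inE ?inordK //=.
- by rewrite /ord_adj /ptree_adj !inordK // i0 eqxx orbT.
- by rewrite ltnn.
move=> a b ab; rewrite !inE -leqNgt => ai ib.
have lt : a < b by apply: leq_trans ib.
rewrite ptree_sym in ab; have e := ptree_adj_lt lt ab.
have bi : b = i :> nat.
  apply/eqP; rewrite eqn_leq ib andbT leqNgt; apply/negP => /cut.
  by rewrite -e leqNgt ai.
by split; apply: ord_inj; rewrite inordK // e bi.
Qed.

Lemma card_ord_lt i : i <= N.+1 -> #|[set x : 'I_N.+1 | x < i]| = i.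
Proof.
move=> iN; have inj : injective (widen_ord iN) by move=> a b /(congr1 val) /= e; apply: val_inj.
rewrite -[RHS]card_ord -cardsT -(card_imset _ inj); congr #|pred_of_set _|; apply/setP=> x; rewrite inE; apply/idP/imsetP => [lt|[y _ ->]]; last exact: (ltn_ord y).
by exists (Ordinal lt); rewrite ?inE //; apply: val_inj.
Qed.

End ParentTree.

Lemma deg_nbrs (G : graph) (v : G) s : nbrs v s -> deg v = size s.
Proof. by case=> us h; rewrite -(card_uniqP us); apply: eq_card => x; rewrite inE h. Qed.

(** * Binary heaps as rgood trees *)

Definition heap_par i := i.-1./2.

Lemma heap_par_lt i : 0 < i -> heap_par i < i.
Proof. rewrite /heap_par; lia. Qed.

(** Numbered level by level: the [k] vertices below [k] are internal, with children 2i + 1 and 2i +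
    2, and the remaining [k + 1] are leaves. *)
Definition heap k := ptree heap_par_lt k.*2.

Lemma heap_deg k (v : heap k) : 0 < k ->
  deg v = if (v : nat) == 0 then 2 else if (v : nat) < k then 3 else 1.
Proof.
move=> k0; have vk : v <= k.*2 by rewrite -ltnS; apply: (ltn_ord (v : 'I_k.*2.+1)).
have key s : all (fun j => j <= k.*2) s -> uniq s ->
    (forall j, j <= k.*2 -> ptree_adj heap_par v j = (j \in s)) -> deg v = size s.
  move=> h1 h2 h3; rewrite -(size_map (fun j => inord j : heap k)).
  by have := ptree_nbrs heap_par_lt vk h1 h2 h3; rewrite inord_val => /deg_nbrs.
case: eqP => v0; last case: ltnP => vk'.
- apply: (key [:: 1; 2]) => [||j jk]; [rewrite /=; lia|by []|].
  rewrite /ptree_adj /heap_par v0 !inE; lia.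
- apply: (key [:: v.-1./2; v.*2.+1; v.*2.+2]) => [||j jk]; rewrite /= ?inE; [lia|lia|].
  rewrite /ptree_adj /heap_par; lia.
- apply: (key [:: v.-1./2]) => [||j jk]; rewrite /= ?inE; [lia|lia|].
  rewrite /ptree_adj /heap_par; lia.
Qed.

Lemma heap_height k (v : heap k) : height (ord0 : heap k) v = trunc_log 2 v.+1.
Proof.
apply: (@ptree_dist0 _ _ _ (fun i => trunc_log 2 i.+1)) => // i i0.
by rewrite trunc_log2S //; congr (trunc_log 2 _).+1; rewrite /heap_par; lia.
Qed.

Lemma heap_parent k (p v : heap k) :
  parent (ord0 : heap k) p v = (0 < (v : nat)) && ((p : nat) == heap_par v).
Proof.
rewrite /parent !heap_height ptree_adjE /ptree_adj.
have step i : 0 < i -> trunc_log 2 i.+1 = (trunc_log 2 (heap_par i).+1).+1.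
  by move=> i0; rewrite trunc_log2S //; congr (trunc_log 2 _).+1; rewrite /heap_par; lia.
apply/idP/idP => [/andP[/orP[//|/andP[p0 /eqP e]]]|h].
  rewrite (step p) // -e => /eqP; lia.
by case/andP: (h) => v0 /eqP e; rewrite h (step v) // -e eqxx.
Qed.

Lemma heap_rgood k : 0 < k -> rgood (ord0 : heap k).
Proof.
move=> k0; have lt (x : heap k) : x <= k.*2 by rewrite -ltnS; apply: (ltn_ord (x : 'I_k.*2.+1)).
have pend (x : heap k) : pendant x = (k <= (x : nat)).
  rewrite /pendant heap_deg //; have [->|x0] := eqVneq (x : nat) 0; last case: ltnP; lia.
have child (x : heap k) : x < k -> exists y : heap k, y = x.*2.+1 :> nat.
  by move=> xk; exists (inord x.*2.+1); rewrite inordK //; lia.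
split.
- split; first exact: ptree_tree.
  right; split; first by rewrite heap_deg.
  move=> v v0; rewrite heap_deg //; case: eqP => e; last by case: ifP; auto.
  by case/eqP: v0; apply: ord_inj.
- move=> x y; rewrite !pend !heap_height => kx ky.
  (* Doubling [y + 1] adds one level, and x + 1 <= 2 (y + 1) because x <= 2k and k <= y. *)
  rewrite -(@trunc_log2_double (nat_of_ord y).+1) //.
  apply: leq_trunc_log; have := lt x; lia.
(* The order is reversed because internal vertices are numbered before the leaves, while the parents
   must form a final segment. *)
- exists (fun x y : heap k => y <= x).
    split=> [l _|l x y px py _ _ _].
      split=> [x _|x y _ _ /andP[h1 h2]|y x z _ _ _ h1 h2|x y _ _]; rewrite ?leqnn ?leq_total //.
        by apply: ord_inj; apply/eqP; rewrite eqn_leq h1 h2.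
      exact: leq_trans h2 h1.
    rewrite !heap_parent => /andP[x0 /eqP ex] /andP[y0 /eqP ey] ne.
    have {}ne : (px : nat) != py by apply: contraNneq ne => /ord_inj ->.
    move: ne; rewrite ex ey /heap_par; lia.
  move=> x y hx hy /existsP[v /and3P[pv hv]]; rewrite heap_parent => /andP[v0 /eqP ev] yx.
  have yk : y < k by have := lt v; rewrite /heap_par in ev; lia.
  have [w ew] := child y yk.
  have pw : parent (ord0 : heap k) y w by rewrite heap_parent ew /heap_par; lia.
  apply/existsP; exists w; rewrite pw; have /andP[_ /eqP hw] := pw.
  rewrite hw hy eqxx !andbT pend leqNgt; apply/negP => /child[u eu].
  have : parent (ord0 : heap k) w u by rewrite heap_parent eu /heap_par; lia.
  case/andP=> _ /eqP hu.
  have : height (ord0 : heap k) u <= highest_level (ord0 : heap k) by apply: leq_bigmax.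
  by rewrite hu hw hy ltnn.
Qed.

(** * Caterpillars and the eccentricity of their ends *)

Definition cat_par i := i./2.*2.-1.

Lemma cat_par_lt i : 0 < i -> cat_par i < i.
Proof. rewrite /cat_par; lia. Qed.

(* The path is [0, 1, 3, 5, ..., 2q+1], and [2i] hangs on [2i-1]. *)
Definition cat q := ptree cat_par_lt q.*2.+1.

Lemma cat_deg q (v : cat q) :
  deg v = if odd v && (v < q.*2.+1) then 3 else 1.
Proof.
have vk : v <= q.*2.+1 by rewrite -ltnS; apply: (ltn_ord (v : 'I_q.*2.+2)).
have key s : all (fun j => j <= q.*2.+1) s -> uniq s ->
    (forall j, j <= q.*2.+1 -> ptree_adj cat_par v j = (j \in s)) -> deg v = size s.
  move=> h1 h2 h3; rewrite -(size_map (fun j => inord j : cat q)).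
  by have := ptree_nbrs cat_par_lt vk h1 h2 h3; rewrite inord_val => /deg_nbrs.
case: ifP => h.
  apply: (key [:: v.-1.-1; v.+1; v.+2]) => [||j jk]; rewrite /= ?inE; [lia|lia|].
  rewrite /ptree_adj /cat_par; lia.
have [v0|v0] := posnP v.
  apply: (key [:: 1]) => [||j jk]; rewrite /= ?inE; [lia|lia|].
  rewrite /ptree_adj /cat_par v0; lia.
apply: (key [:: cat_par v]) => [||j jk]; rewrite /= ?inE /ptree_adj /cat_par; lia.
Qed.

Lemma cat_caterpillar q : binary_caterpillar (cat q).
Proof.
split.
  split; first exact: ptree_tree.
  by move=> v; rewrite /pendant cat_deg; case: ifP.
exists ord0, [seq inord i.*2.+1 | i <- iota 0 q.+1]; split.
- have st m i : m + i <= q.+1 -> 0 < m -> path (@adj (cat q)) (inord m.*2.-1)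
     [seq inord i.*2.+1 | i <- iota m i].
    elim: i m => // i IH m le m0.
    change (adj (inord m.*2.-1 : cat q) (inord m.*2.+1) &&
      path (@adj (cat q)) (inord m.+1.*2.-1) [seq inord j.*2.+1 | j <- iota m.+1 i]).
    apply/andP; split; last by apply: IH; lia.
    by rewrite ptree_adjE /ptree_adj /cat_par !inordK /=; lia.
  change (adj (ord0 : cat q) (inord 1) &&
    path (@adj (cat q)) (inord 1.*2.-1) [seq inord j.*2.+1 | j <- iota 1 q]).
  apply/andP; split; last by apply: st; lia.
  by rewrite ptree_adjE /ptree_adj /cat_par inordK /=; lia.
- rewrite cons_uniq map_inj_in_uniq ?iota_uniq ?andbT; last first.
    move=> i j; rewrite !mem_iota => hi hj /(congr1 val) /=; rewrite !inordK; lia.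
  apply/negP => /mapP[i]; rewrite mem_iota => hi /(congr1 val) /=; rewrite inordK; lia.
- move=> v; have vk : v <= q.*2.+1 by rewrite -ltnS; apply: (ltn_ord (v : 'I_q.*2.+2)).
  rewrite inE negb_or => /andP[v0 vS].
  have v0' : 0 < v by rewrite lt0n; apply: contra v0 => /eqP e; apply/eqP; apply: ord_inj.
  have ev : ~~ odd v.
    apply: contra vS => ov; apply/mapP; exists v./2; first by rewrite mem_iota; lia.
    by apply: ord_inj; rewrite inordK; lia.
  exists (inord v.-1).
    rewrite inE; apply/orP; right; apply/mapP; exists v.-1./2; first by rewrite mem_iota; lia.
    by congr inord; lia.
  by rewrite ptree_adjE /ptree_adj /cat_par inordK; lia.
Qed.

(* The distance in the caterpillar, up to the value at [x = u]. *)
Definition cat_gap x u :=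
  ((0 < x) && ~~ odd x) + ((0 < u) && ~~ odd u)
  + ((uphalf x - uphalf u) + (uphalf u - uphalf x)).

Lemma cat_gap_step q x u : x <= q.*2.+1 -> u <= q.*2.+1 -> x != u ->
  exists z, [/\ z <= q.*2.+1, ptree_adj cat_par x z & z = u \/ cat_gap z u < cat_gap x u].
Proof.
rewrite /cat_gap /ptree_adj /cat_par => xq uq xu.
have [ex|ex] := boolP ((0 < x) && ~~ odd x).
  by exists x.-1; split; [lia|lia|right; lia].
have [lt|lt|eq] := ltngtP (uphalf x) (uphalf u).
- by exists (uphalf x).*2.+1; split; [lia|lia|right; lia].
- by exists (x./2.*2.-1); split; [lia|lia|right; lia].
- by exists u; split; [lia|lia|left].
Qed.

(** [uphalf] gives the position along the path, from 0 to [q.+1]. A leaf off the path costs one more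
    step, but its position lies between 1 and [q], so no distance exceeds [q.+1]; vertex 2q + 1
    realizes it from 0. *)
Lemma cat_max_ecc q : max_ecc_vertex (ord0 : cat q).
Proof.
have lt (x : cat q) : x <= q.*2.+1 by rewrite -ltnS; apply: (ltn_ord (x : 'I_q.*2.+2)).
move=> u; apply: (@leq_trans q.+1).
  apply/bigmax_leqP => w _.
  pose f (x : cat q) := if x == u then 0 else cat_gap x u.
  apply: leq_trans (_ : f w <= _); last first.
    rewrite /f; case: eqVneq => // wu; have {}wu : (w : nat) != u by apply: contraNneq wu => /ord_inj ->.
    have := lt w; have := lt u; rewrite /cat_gap; lia.
  apply: (@dist_le_potential _ f) => x xu; have xu' : (x : nat) != u by apply: contraNneq xu => /ord_inj ->.
  have [z [zq xz zu]] := cat_gap_step (lt x) (lt u) xu'.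
  exists (inord z); first by rewrite ptree_adjE inordK.
  rewrite /f (negPf xu); case: eqVneq => zu'.
    by move: xu'; rewrite /cat_gap; lia.
  case: zu => [e|]; last by rewrite inordK.
  by case/eqP: zu'; apply: ord_inj; rewrite inordK.
pose z : cat q := ord_max.
apply: leq_trans (_ : dist z ord0 <= _); last exact: (@leq_bigmax _ (fun w : cat q => dist w ord0)).
pose f (x : cat q) := q.+1 - uphalf x.
have e : f ord0 - f z = q.+1 by rewrite /f /=; lia.
rewrite -{1}e; apply: dist_ge_lipschitz; last by rewrite e card_ord; lia.
move=> a b; rewrite ptree_adjE /ptree_adj /cat_par /f; lia.
Qed.

(** * The glued tree in coordinates *)

Definition crg_par k j :=
  if j <= k.*2 then heap_par j
  else if j == k.*2.+1 then 0 else k.*2 + cat_par (j - k.*2).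

Lemma crg_par_lt k j : 0 < j -> crg_par k j < j.
Proof. rewrite /crg_par /heap_par /cat_par; case: ifP => h; [lia|case: eqP; lia]. Qed.

(* The heap on [0, ..., 2k] and the caterpillar on [0, 2k+1, ..., 2k+2q+1]. *)
Definition crg k q := ptree (@crg_par_lt k) (k.*2 + q.*2.+1).

Lemma crg_glue k q : isomorphic (crg k q) (glue (ord0 : heap k) (ord0 : cat q)).
Proof.
have ltR (x : heap k) : x <= k.*2 by rewrite -ltnS; apply: (ltn_ord (x : 'I_k.*2.+1)).
have ltC (x : cat q) : x <= q.*2.+1 by rewrite -ltnS; apply: (ltn_ord (x : 'I_q.*2.+2)).
pose H := glue (ord0 : heap k) (ord0 : cat q).
pose r (x : heap k) : nat := (x : 'I_k.*2.+1).
pose c (y : {x : cat q | x != ord0}) : nat := (val y : 'I_q.*2.+2).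
pose g (a : H) : nat := match a with inl x => r x | inr y => k.*2 + c y end.
pose f (a : H) : crg k q := inord (g a).
have r_le x : r x <= k.*2 := ltR x.
have c_le y : c y <= q.*2.+1 := ltC (val y).
have c_gt0 y : 0 < c y.
  by rewrite lt0n; apply: contra (valP y) => /eqP e; apply/eqP; apply: ord_inj.
have gK a : f a = g a :> nat.
  rewrite inordK // ltnS; case: a => [x|y] /=; last by rewrite leq_add2l.
  by apply: leq_trans (r_le x) _; apply: leq_addr.
have inj : injective f.
  move=> a b /(congr1 (fun x : crg k q => x : nat)); rewrite !gK.
  case: a b => [x|x] [y|y] /= e.
  - by congr inl; apply: ord_inj.
  - by have := r_le x; rewrite e -[leqRHS]addn0 leq_add2l leqNgt c_gt0.
  - by have := r_le y; rewrite -e -[leqRHS]addn0 leq_add2l leqNgt c_gt0.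
  - by congr inr; apply: val_inj; apply: ord_inj; apply: (@addnI k.*2).
have [g' fK g'K] : bijective f.
  apply: (inj_card_bij inj); rewrite card_sum card_sig !card_ord.
  rewrite (_ : #|_| = q.*2.+1); first by rewrite addSn addnS.
  by have := cardC1 (ord0 : 'I_q.*2.+2); rewrite card_ord.
have adj_f a b : adj (f a) (f b) = adj a b.
  rewrite ptree_adjE !gK; case: a b => [x|x] [y|y].
  - change (ptree_adj (crg_par k) (r x) (r y) = ptree_adj heap_par (r x) (r y)).
    by rewrite /ptree_adj /crg_par !r_le.
  - change (ptree_adj (crg_par k) (r x) (k.*2 + c y)
      = (r x == 0) && ptree_adj cat_par 0 (c y)).
    move: (r x) (c y) (r_le x) (c_gt0 y); clear => {}x {}y xk y0.
    rewrite /ptree_adj /crg_par /cat_par /heap_par xk.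
    case: ifP => h1; first lia.
    have [h2|h2] := eqVneq (k.*2 + y) k.*2.+1; lia.
  - change (ptree_adj (crg_par k) (k.*2 + c x) (r y)
      = (r y == 0) && ptree_adj cat_par 0 (c x)).
    move: (r y) (c x) (r_le y) (c_gt0 x); clear => {}y {}x yk x0.
    rewrite /ptree_adj /crg_par /cat_par /heap_par yk.
    case: ifP => h1; first lia.
    have [h2|h2] := eqVneq (k.*2 + x) k.*2.+1; lia.
  - change (ptree_adj (crg_par k) (k.*2 + c x) (k.*2 + c y) = ptree_adj cat_par (c x) (c y)).
    move: (c y) (c x) (c_gt0 y) (c_gt0 x); clear => {}y {}x y0 x0.
    rewrite /ptree_adj /crg_par /cat_par /heap_par.
    have -> : (k.*2 + x <= k.*2) = false by lia.
    have -> : (k.*2 + y <= k.*2) = false by lia.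
    have [h3|h3] := eqVneq (k.*2 + x) k.*2.+1; have [h4|h4] := eqVneq (k.*2 + y) k.*2.+1; lia.
exists g'; split; first by exists f.
by move=> x y; rewrite -[in RHS](g'K x) -[in RHS](g'K y) adj_f.
Qed.

Lemma crg_is_crg k q : 0 < k -> crg_tree (k.*2 + q.*2.+2) k.*2.+1 (crg k q).
Proof.
move=> k0; split; try lia.
exists (heap k), (cat q), ord0, ord0; split.
- by split; [apply: heap_rgood|rewrite card_ord].
- by split; [apply: cat_caterpillar|rewrite card_ord; lia].
- exact: cat_max_ecc.
- exact: crg_glue.
Qed.

(** * Rooted subtrees and sides in the crg tree *)

Section Crg.
Variables k q : nat.
Hypothesis k_gt0 : 0 < k.

Let X := crg k q.
Let vtx (i : nat) : X := inord i.
Let treeX : tree X := ptree_tree (@crg_par_lt k) (k.*2 + q.*2.+1).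

(* The neighbour of [i] away from its children, for [i] in the heap. *)
Let up i := if i == 0 then k.*2.+1 else i.-1./2.

Lemma crg_nbrs i s : i <= k.*2 + q.*2.+1 -> all (fun j => j <= k.*2 + q.*2.+1) s ->
  uniq s -> (forall j, j <= k.*2 + q.*2.+1 -> ptree_adj (crg_par k) i j = (j \in s)) ->
  nbrs (vtx i) (map vtx s).
Proof. exact: ptree_nbrs. Qed.

Lemma crg_par_heap j : j <= k.*2 -> crg_par k j = j.-1./2.
Proof. by rewrite /crg_par => ->. Qed.

Lemma crg_par_cat j : k.*2 < j ->
  crg_par k j = if j == k.*2.+1 then 0 else k.*2 + (j - k.*2)./2.*2.-1.
Proof. by rewrite ltnNge /crg_par => /negPf ->. Qed.

Lemma crg_heap_node i : i < k -> nbrs (vtx i) [:: vtx (up i); vtx i.*2.+1; vtx i.*2.+2].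
Proof.
move=> ik; apply: (crg_nbrs (s := [:: up i; i.*2.+1; i.*2.+2])) => [||| j jN].
- lia.
- by rewrite /up /=; case: (eqVneq i 0) => i0; lia.
- by rewrite /up /= !inE; case: (eqVneq i 0) => i0; lia.
rewrite /ptree_adj (@crg_par_heap i) ?inE /up; last lia.
have [jk|jk] := leqP j k.*2; first by rewrite crg_par_heap //; case: (eqVneq i 0) => i0; lia.
rewrite crg_par_cat //; have [->|j1] := eqVneq j k.*2.+1; case: (eqVneq i 0) => i0; lia.
Qed.

Lemma crg_heap_leaf i : k <= i <= k.*2 -> nbrs (vtx i) [:: vtx (up i)].
Proof.
move=> ik; apply: (crg_nbrs (s := [:: up i])) => [||| j jN] //.
- lia.
- by rewrite /up /=; case: (eqVneq i 0) => i0; lia.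
rewrite /ptree_adj (@crg_par_heap i) ?inE /up; last lia.
have [jk|jk] := leqP j k.*2; first by rewrite crg_par_heap //; case: (eqVneq i 0) => i0; lia.
rewrite crg_par_cat //; have [->|j1] := eqVneq j k.*2.+1; case: (eqVneq i 0) => i0; lia.
Qed.

(* Heap positions are shifted by 1, so that the children of [j] are [2j] and
   [2j+1], and its descendants at depth [m] are [2^m j, ..., 2^m (j+1) - 1];
   those smaller than [k+1] are internal. *)
Lemma crg_nrooted_heap m j : 0 < j -> k < 2 ^ m.+1 * j -> 2 ^ m * j.+1 <= k.+1.*2 ->
  (nrooted (vtx (up j.-1)) (vtx j.-1)).+1 =
  hopt (2 ^ m + minn (2 ^ m) (k.+1 - 2 ^ m * j)).
Proof.
have node i : i < k -> nrooted (vtx (up i)) (vtx i) =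
    (nrooted (vtx i) (vtx i.*2.+1)).+1 * (nrooted (vtx i) (vtx i.*2.+2)).+1.
  by move=> ik; apply: nrooted3 treeX _ _ _ _ (crg_heap_node ik).
have leaf i : k <= i <= k.*2 -> nrooted (vtx (up i)) (vtx i) = 1.
  by move=> ik; apply: nrooted1 treeX _ _ (crg_heap_leaf ik).
(* The hypotheses say that all descendants at depth [m] exist and that none at depth [m.+1] is
   internal; the [minn] counts the internal ones at depth [m]. *)
elim: m j => [|m IH] [//|i] _ /=.
  rewrite expn1 expn0 !mul1n => l1 l2.
  have [ik|ki] := ltnP i k.
    have -> : 1 + minn 1 (k.+1 - i.+1) = 2 by lia.
    rewrite node //.
    have -> : nrooted (vtx i) (vtx i.*2.+1) = 1.
      by rewrite -(leaf i.*2.+1); [congr (nrooted (vtx _) _); rewrite /up /=|]; lia.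
    have -> : nrooted (vtx i) (vtx i.*2.+2) = 1.
      by rewrite -(leaf i.*2.+2); [congr (nrooted (vtx _) _); rewrite /up /=|]; lia.
    by [].
  have -> : 1 + minn 1 (k.+1 - i.+1) = 1 by lia.
  by rewrite leaf //; lia.
have e0 : 0 < 2 ^ m by rewrite expn_gt0.
have eSS := expnS 2 m.+1; have eS := expnS 2 m; rewrite eSS eS => l1 l2.
have ik : i < k by nia.
rewrite node //.
have := IH i.+1.*2.+1 isT; have := IH i.+1.*2 isT; rewrite eS.
have -> : vtx (up i.+1.*2.-1) = vtx i by congr vtx; rewrite /up /=; lia.
have -> : vtx (up i.+1.*2.+1.-1) = vtx i by congr vtx; rewrite /up /=; lia.
move=> /(_ (ltac:(nia)) (ltac:(nia))) -> /(_ (ltac:(nia)) (ltac:(nia))) ->.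
move: eS e0 l1 l2; set c := 2 ^ m => eS e0 l1 l2.
have low d : c <= d <= c.*2 -> (hopt c * hopt d).+1 = hopt (c + d).
  by move=> hd; rewrite hopt_low // -/c eS; lia.
have high d : c <= d <= c.*2 -> (hopt c.*2 * hopt d).+1 = hopt (c.*2 + d).
  by move=> hd; have := @hopt_high m d; rewrite eS mul2n -/c => ->.
have m1 : c * i.+1.*2 = 2 * (c * i.+1) by lia.
have m2 : c * i.+1.*2.+1 = 2 * (c * i.+1) + c by lia.
rewrite m1 m2 -mulnA; move: (c * i.+1) l1 l2 m1 m2 => z l1 l2 m1 m2.
(* The left child gets the internal vertices of the last level first: either the right half has
   none, or the left half is complete. *)
have [h|h] := leqP (k.+1 - 2 * z) c.
  rewrite (_ : minn c (k.+1 - (2 * z + c)) = 0); last lia.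
  rewrite addn0 [hopt _ * hopt _]mulnC.
  rewrite (_ : minn (2 * c) (k.+1 - 2 * z) = k.+1 - 2 * z); last lia.
  by rewrite low; [congr hopt|]; lia.
by rewrite addnn high; [congr hopt|]; lia.
Qed.

Lemma crg_nrooted_root : (nrooted (vtx k.*2.+1) (vtx 0)).+1 = hopt k.+1.
Proof.
have /andP[] := @trunc_log_bounds 2 k.+1 isT isT; move: (trunc_log 2 k.+1) => m l1 l2.
rewrite (@crg_nrooted_heap m 1) ?muln1 //; [|exact: ltnW|lia].
by congr hopt; move: l2; rewrite expnS; lia.
Qed.

Lemma crg_nrooted_cat t s : t + s = q ->
  (nrooted (vtx (crg_par k (k.*2 + t.*2.+1))) (vtx (k.*2 + t.*2.+1))).+1 = hcat s.+1.
Proof.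
elim: s t => [|s IH] t ts.
  rewrite (nrooted1 treeX) //.
  set u := crg_par k _; apply: (crg_nbrs (s := [:: u])) => [||| j jN] //.
  - lia.
  - by rewrite /u /= (leq_trans (ltnW (crg_par_lt _ _))); lia.
  rewrite inE /ptree_adj -/u.
  have [jk|jk] := leqP j k.*2; first by rewrite crg_par_heap //; lia.
  by rewrite crg_par_cat //; have [e|j1] := eqVneq j k.*2.+1; lia.
set u := crg_par k _; set v := k.*2 + t.*2.+1.
have uv : u < v by apply: crg_par_lt; rewrite /v; lia.
have hn : nbrs (vtx v) [:: vtx u; vtx v.+1; vtx v.+2].
  apply: (crg_nbrs (s := [:: u; v.+1; v.+2])) => [||| j jN].
  - by rewrite /v; lia.
  - by move: uv; rewrite /v /=; lia.
  - by move: uv; rewrite /= !inE /v; lia.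
  rewrite !inE /ptree_adj -/u.
  have [jk|jk] := leqP j k.*2; first by rewrite crg_par_heap // /v; lia.
  by rewrite crg_par_cat //; have [e|j1] := eqVneq j k.*2.+1; rewrite /v; lia.
rewrite (nrooted3 treeX hn) hcat_succ //.
have -> : nrooted (vtx v) (vtx v.+1) = 1.
  apply: (nrooted1 treeX); apply: (crg_nbrs (s := [:: v])) => [||| j jN] //.
  - by rewrite /v; lia.
  - by rewrite /v /=; lia.
  have ev : crg_par k v.+1 = v by rewrite crg_par_cat /v; [case: eqP|]; lia.
  rewrite inE /ptree_adj ev.
  have [jk|jk] := leqP j k.*2; first by rewrite crg_par_heap // /v; lia.
  by rewrite crg_par_cat //; have [e|j1] := eqVneq j k.*2.+1; rewrite /v; lia.
rewrite -(IH t.+1); last lia.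
have -> : k.*2 + t.+1.*2.+1 = v.+2 by rewrite /v; lia.
have -> : crg_par k v.+2 = v by rewrite crg_par_cat /v; [case: eqP|]; lia.
by [].
Qed.

Lemma crg_dist d : 0 < d -> hcat q.+1 < hopt k.+1 ->
  (k.*2.+1 + d.-1.*2).*2 < k.*2 + q.*2.+2 ->
  d <= set_dist (centroid X) (subtree_core X).
Proof.
move=> d0 hF hs; set N := k.*2 + q.*2.+1.
have cut i : k.*2 < i -> odd i -> i <= N ->
    side (vtx i) (vtx (crg_par k i)) = [set x : 'I_N.+1 | x < i].
  move=> ki oi iN; apply: ptree_cut => //; first lia.
  by move=> j ij; rewrite crg_par_cat; [case: eqP|]; lia.
have edge i : 0 < i -> i <= N -> adj (vtx i) (vtx (crg_par k i)).
  move=> i0 iN; have := crg_par_lt k i0 => lt.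
  rewrite ptree_adjE /ptree_adj !inordK ?ltnS // ?i0 ?eqxx ?orbT //.
  by apply: leq_trans iN; apply: ltnW.
have core (y : X) : y \in subtree_core X -> (y : 'I_N.+1) < k.*2.+1.
  move=> yc; have e1 : crg_par k k.*2.+1 = 0 by rewrite crg_par_cat // eqxx.
  have := edge k.*2.+1 isT; rewrite e1 /N => /(_ (ltac:(lia))) E.
  have := @core_side _ treeX _ _ y E _ yc.
  have := cut k.*2.+1; rewrite e1 => ->; try (rewrite /N; lia).
  rewrite inE; apply.
  rewrite -ltnS crg_nrooted_root; have := @crg_nrooted_cat 0 q erefl.
  by rewrite addn1 e1 => ->.
(* The edge from [i] to its parent cuts off exactly [i] vertices, the heap and two per step: the
   estimate of [side_path] is attained in the crg tree. *)
pose i := k.*2.+1 + d.-1.*2.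
have cent (x : X) : x \in centroid X -> i <= (x : 'I_N.+1).
  move=> xc; have E := edge i (ltac:(lia)) (ltac:(lia)).
  have E' : adj (vtx (crg_par k i)) (vtx i) by rewrite adj_sym.
  have e := cut i (ltac:(lia)) (ltac:(lia)) (ltac:(lia)).
  have ci : #|side (vtx i) (vtx (crg_par k i))| = i by rewrite e card_ord_lt //; lia.
  have cs := card_sideC treeX E; rewrite ci card_ord in cs.
  have lt : #|side (vtx i) (vtx (crg_par k i))| < #|side (vtx (crg_par k i)) (vtx i)|.
    by rewrite ci; move: cs hs; rewrite -/i /N; move: #|_|; clear; lia.
  have := centroid_side treeX E' lt xc.
  by rewrite (in_sideC treeX) // e inE -leqNgt.
apply: set_dist_ge; first by rewrite card_ord; lia.
move=> x y /cent xi /core yk.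
(* [f] is [q.+1] on the heap, changes by at most 1 along an edge, and is at most [q.+1 - d] from
   vertex [i] on. *)
pose f (x : X) := q.+1 - uphalf ((x : 'I_N.+1) - k.*2).
have xN : x <= N by rewrite -ltnS; apply: (ltn_ord (x : 'I_N.+1)).
apply: (@leq_trans (f y - f x)); first by rewrite /f /i in xi *; lia.
apply: dist_ge_lipschitz; last by rewrite card_ord /f; lia.
move=> a b; have aN : a <= N by rewrite -ltnS; apply: (ltn_ord (a : 'I_N.+1)).
have bN : b <= N by rewrite -ltnS; apply: (ltn_ord (b : 'I_N.+1)).
rewrite ptree_adjE /ptree_adj /f.
move: (a : nat) (b : nat) aN bN; clear - k => {}a {}b aN bN.
have step z : 0 < z -> uphalf (z - k.*2) <= (uphalf (crg_par k z - k.*2)).+1.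
  move=> z0; have [zk|zk] := leqP z k.*2; first by rewrite crg_par_heap //; lia.
  by rewrite crg_par_cat //; case: eqP; lia.
have step' z : 0 < z -> uphalf (crg_par k z - k.*2) <= uphalf (z - k.*2).
  by move=> z0; have := crg_par_lt k z0; lia.
case/orP=> /andP[z0 /eqP e]; have := step _ z0; have := step' _ z0; rewrite -e; lia.
Qed.

End Crg.

Theorem theorem3p11 (n : nat) (hn : 12 <= n) (hn_even : ~~ odd n) :
  exists (l : nat) (Tstar : graph),
    crg_tree n l Tstar /\
    forall T : graph, binary_tree T -> #|T| = n ->
      set_dist (centroid T) (subtree_core T)
        <= set_dist (centroid Tstar) (subtree_core Tstar).
Proof.
pose N := n./2.-1.
pose D (k : 'I_N) :=
  set_dist (centroid (crg k (N - k))) (subtree_core (crg k (N - k))).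
have one : 1 < N by rewrite /N; lia.
(* The crg tree compared with [T] depends on [T], so [Tstar] is chosen as the best among all of
   them; [n = 2N + 2] makes [N - k] the matching caterpillar parameter. *)
case: (@arg_maxnP _ (Ordinal one) (fun k : 'I_N => 0 < k) D isT) => k k0 maxk.
have sz (j : nat) : j < N -> j.*2 + (N - j).*2.+2 = n by rewrite /N; lia.
exists k.*2.+1, (crg k (N - k)); split.
  by have := crg_is_crg (N - k) k0; rewrite sz.
move=> T binT cT.
have /card_gt0P[z0 _] : 0 < #|T| by rewrite cT; lia.
have [x0 x0c] : exists x0 : T, x0 \in centroid T.
  case: (@arg_minnP _ z0 xpredT (@weight T) isT) => x0 _ min.
  by exists x0; rewrite inE; apply/forallP => u; apply: min.
have [y0 y0c] : exists y0 : T, y0 \in subtree_core T.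
  case: (@arg_maxnP _ z0 xpredT (@nb_subtrees T) isT) => y0 _ max.
  by exists y0; rewrite inE; apply/forallP => u; apply: max.
pose P (p : T * T) := (p.1 \in centroid T) && (p.2 \in subtree_core T).
have P0 : P (x0, y0) by rewrite /P x0c y0c.
case: (@arg_minnP _ _ P (fun p => dist p.1 p.2) P0) => -[x y] /andP[/= xc yc] minxy.
apply: leq_trans (set_dist_le xc yc) _.
have [->//|d0] := posnP (dist x y).
have dmin : {in centroid T & subtree_core T, forall x' y', dist x y <= dist x' y'}.
  by move=> x' y' x'c y'c; apply: (minxy (x', y')); rewrite /P x'c y'c.
have [k1 [k2 [k10 k20 e lt hs]]] := binary_dist binT xc yc d0 dmin.
rewrite cT in e hs; move: d0 hs; move: (dist x y) => d d0 hs.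
(* A heap with [k1] leaves has [k1 - 1] internal vertices and must have at least one; [k1 = 1] is
   excluded because [hopt 1 = 2] does not exceed [hcat k2]. *)
have k1_gt1 : 1 < k1.
  rewrite ltn_neqAle k10 andbT; apply: contraTneq lt => <-.
  by rewrite -leqNgt /hcat; have := expn_gt0 2 k2.-1; rewrite /hopt /=; lia.
have jN : k1.-1 < N by rewrite /N; lia.
apply: leq_trans (maxk (Ordinal jN) _); last by rewrite /=; lia.
have e2 : (N - k1.-1).+1 = k2 by rewrite /N; lia.
by apply: crg_dist => //=; rewrite ?e2 ?(sz _ jN) ?prednK //; lia.
Qed.
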